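(* Let $n\ge 3$, let $c\in\mathbb{R}$, and let $M^n$ be an $n$-dimensional connected hypersurface immersed in a real space form $\mathbb{Q}_c^{n+1}$ of constant sectional curvature $c$, with constant Ricci eigenvalues. If one of the following conditions is satisfied: (1) $M^n$ has at least three distinct constant Ricci eigenvalues; (2) $(n-1)c$ is not a Ricci eigenvalue of $M^n$; (3) the multiplicity of the Ricci eigenvalue $(n-1)c$ is not one of $\{n,n-2\}$; then $M^n$ is isoparametric.
   Context: $\mathbb{Q}_c^{n+1}$ denotes the simply connected real space form of dimension $n+1$ and constant sectional curvature $c$. Everything is smooth; $M^n$ is given by an immersion into $\mathbb{Q}_c^{n+1}$ and carries the induced metric $g$. A unit normal vector field $\nu$ along $M$ is fixed, $A$ is the shape operator with respect to $\nu$, and its eigenvalues (with multiplicity) are the principal curvatures. The hypersurface is called isoparametric if all its principal curvatures are constant on $M$. The Ricci eigenvalues of $M$ at $p$ are the eigenvalues of the self-adjoint Ricci operator $\widehat{\mathrm{Ric}}_p\colon T_pM\to T_pM$ defined by $g(\widehat{\mathrm{Ric}}(X),Y)=\mathrm{Ric}(X,Y)$. $M$ has constant Ricci eigenvalues if these eigenvalues, counted with multiplicity, do not depend on the point $p\in M$. *)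

(* Defs.v *)
From HB Require Import structures.
From mathcomp Require Import all_boot all_order all_algebra.
From mathcomp Require Import all_classical all_reals all_analysis.

Set Implicit Arguments.
Unset Strict Implicit.
Unset Printing Implicit Defensive.

Import Order.TTheory GRing.Theory Num.Theory.
Import numFieldNormedType.Exports.

Local Open Scope classical_set_scope.
Local Open Scope ring_scope.

Section Calculus.
Context {R : realType} {n : nat}.

Definition partial {V : normedModType R} (i : 'I_n) (F : 'rV[R]_n -> V) :
  'rV[R]_n -> V := fun u => 'D_(delta_mx 0 i) F u.

Definition iter_partial {V : normedModType R} (s : seq 'I_n)
  (F : 'rV[R]_n -> V) : 'rV[R]_n -> V := foldr partial F s.

(* C^oo on the open set U: F and its partial derivatives of every order are
   differentiable (in particular continuous) at every point of U. *)
Definition smooth_on {V : normedModType R} (U : set 'rV[R]_n)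
    (F : 'rV[R]_n -> V) : Prop :=
  forall (s : seq 'I_n) (u : 'rV[R]_n), U u -> differentiable (iter_partial s F) u.

End Calculus.

Section Manifolds.
Context {R : realType} {n : nat}.

Record chart (M : topologicalType) := Chart {
  chart_dom : set M;
  chart_map : M -> 'rV[R]_n;
  chart_inv : 'rV[R]_n -> M }.

Definition chart_codom (M : topologicalType) (phi : chart M) : set 'rV[R]_n :=
  chart_map phi @` chart_dom phi.

(* chart_map and chart_inv are total functions; only their values on
   chart_dom and chart_codom matter. *)
Definition is_chart (M : topologicalType) (phi : chart M) : Prop :=
  [/\ open (chart_dom phi),
      open (chart_codom phi),
      forall p, chart_dom phi p -> chart_inv phi (chart_map phi p) = p,
      {within chart_dom phi, continuous (chart_map phi)}
    & {within chart_codom phi, continuous (chart_inv phi)}].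

Definition smooth_transition (M : topologicalType) (phi psi : chart M) : Prop :=
  smooth_on (chart_map phi @` (chart_dom phi `&` chart_dom psi))
            (chart_map psi \o chart_inv phi).

Record smooth_manifold := SmoothManifold {
  carrier :> topologicalType;
  atlas : set (chart carrier);
  manifold_hausdorff : hausdorff_space carrier;
  manifold_second_countable : @second_countable carrier;
  atlas_chart : forall phi, atlas phi -> is_chart phi;
  atlas_cover : forall p : carrier, exists2 phi, atlas phi & chart_dom phi p;
  atlas_smooth : forall phi psi, atlas phi -> atlas psi ->
    smooth_transition phi psi }.

Definition local_expr (M : smooth_manifold) {V : normedModType R}
  (f : M -> V) (phi : chart M) : 'rV[R]_n -> V := f \o chart_inv phi.

Definition smooth_map (M : smooth_manifold) {V : normedModType R}
    (f : M -> V) : Prop :=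
  forall phi, atlas phi -> smooth_on (chart_codom phi) (local_expr f phi).

End Manifolds.

Arguments chart R n M : clear implicits.
Arguments smooth_manifold R n : clear implicits.

Section RiemannianCoordinates.
(* Tensors of a metric given in coordinates by its Gram matrix g. *)
Context {R : realType} {n : nat} (g : 'rV[R]_n -> 'M[R]_n).

(* Gamma^k_{ij} = 1/2 g^{kl} (d_i g_{jl} + d_j g_{il} - d_l g_{ij}) *)
Definition christoffel (k i j : 'I_n) (u : 'rV[R]_n) : R :=
  2^-1 * \sum_(l < n) invmx (g u) k l *
    (partial i (fun v => g v j l) u + partial j (fun v => g v i l) u
     - partial l (fun v => g v i j) u).

(* R(d_i, d_j) d_k = sum_l (riemann l k i j) d_l,
   with R(X, Y) = [nabla_X, nabla_Y] - nabla_[X, Y] *)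
Definition riemann (l k i j : 'I_n) (u : 'rV[R]_n) : R :=
  partial i (christoffel l j k) u - partial j (christoffel l i k) u
  + \sum_(p < n) (christoffel l i p u * christoffel p j k u
                  - christoffel l j p u * christoffel p i k u).

(* Ric(Y, Z) = trace (X |-> R(X, Y) Z) *)
Definition ricci (u : 'rV[R]_n) : 'M[R]_n :=
  \matrix_(j, k) \sum_(i < n) riemann i k i j u.

(* The matrix T, acting on row vectors of components by X |-> X *m T, of the
   endomorphism such that g(T X, Y) = b(X, Y), i.e. T *m g = b. *)
Definition raise_index (b : 'M[R]_n) (u : 'rV[R]_n) : 'M[R]_n :=
  b *m invmx (g u).

End RiemannianCoordinates.

Section SpaceForms.
Context {R : realType} {n : nat}.

(* Euclidean form on R^{n+2} if 0 <= c, Lorentzian form if c < 0. *)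
Definition ambient_form (c : R) (x y : 'rV[R]_n.+2) : R :=
  (if c < 0 then -1 else 1) * (x 0 0 * y 0 0)
  + \sum_(i < n.+1) x 0 (lift ord0 i) * y 0 (lift ord0 i).

(* The space form Q_c^{n+1} inside R^{n+2}: the round sphere of radius
   1 / sqrt c if 0 < c, the hyperplane x_0 = 0 if c = 0, the upper sheet of
   the hyperboloid <x, x> = 1 / c if c < 0. Its metric is the restriction of
   ambient_form to its tangent spaces. *)
Definition space_form (c : R) : set 'rV[R]_n.+2 :=
  [set x : 'rV[R]_n.+2 | if c == 0 then x 0 0 = 0
           else ambient_form c x x = c^-1 /\ (c < 0 -> 0 < x 0 0)].

Definition space_form_tangent (c : R) (x : 'rV[R]_n.+2) : set 'rV[R]_n.+2 :=
  [set v : 'rV[R]_n.+2 | if c == 0 then v 0 0 = 0 else ambient_form c x v = 0].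

End SpaceForms.

Section Hypersurfaces.
Context {R : realType} {n : nat} (c : R) (M : smooth_manifold R n).
Implicit Types (f nu : M -> 'rV[R]_n.+2) (phi : chart R n M).

Definition immersed_hypersurface f : Prop :=
  [/\ smooth_map f,
      forall p, space_form c (f p)
    & forall phi, atlas phi -> forall u, chart_codom phi u ->
        row_free ('J (local_expr f phi) u)].

Definition unit_normal_field f nu : Prop :=
  [/\ smooth_map nu,
      forall p, space_form_tangent c (f p) (nu p),
      forall p, ambient_form c (nu p) (nu p) = 1
    & forall phi, atlas phi -> forall u, chart_codom phi u -> forall i,
        ambient_form c (local_expr nu phi u) (partial i (local_expr f phi) u) = 0].

Definition induced_metric f phi (u : 'rV[R]_n) : 'M[R]_n :=
  \matrix_(i, j) ambient_form c (partial i (local_expr f phi) u)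
                                (partial j (local_expr f phi) u).

(* The Levi-Civita connection of the space form is the tangential part of the
   flat derivative of R^{n+2}, so g(A X, Y) = - <nabla_X nu, df Y>
   is computed with the flat derivative of nu. *)
Definition second_fundamental_form f nu phi (u : 'rV[R]_n) : 'M[R]_n :=
  \matrix_(i, j) - ambient_form c (partial i (local_expr nu phi) u)
                                  (partial j (local_expr f phi) u).

(* A field of endomorphisms of TM: its matrix in the coordinate frame of each
   chart at each point. *)
Definition endomorphism_field := chart R n M -> M -> 'M[R]_n.

Definition ricci_operator f : endomorphism_field := fun phi p =>
  let g := induced_metric f phi in
  let u := chart_map phi p in
  raise_index g (ricci g u) u.

Definition shape_operator f nu : endomorphism_field := fun phi p =>
  let g := induced_metric f phi in
  let u := chart_map phi p in
  raise_index g (second_fundamental_form f nu phi u) u.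

(* For self-adjoint fields: algebraic and geometric multiplicities agree. *)
Definition multiplicity (A : 'M[R]_n) (a : R) : nat := \rank (eigenspace A a).

(* The eigenvalues, with multiplicity, are the same at all points. *)
Definition constant_eigenvalues (T : endomorphism_field) : Prop :=
  forall phi psi, atlas phi -> atlas psi ->
  forall p q, chart_dom phi p -> chart_dom psi q ->
  forall a, multiplicity (T phi p) a = multiplicity (T psi q) a.

Definition constant_ricci_eigenvalues f : Prop :=
  constant_eigenvalues (ricci_operator f).

Definition isoparametric f nu : Prop :=
  constant_eigenvalues (shape_operator f nu).

Definition three_distinct_ricci_eigenvalues f : Prop :=
  exists a1 a2 a3 : R, uniq [:: a1; a2; a3] /\
  forall phi, atlas phi -> forall p, chart_dom phi p ->
    all (eigenvalue (ricci_operator f phi p)) [:: a1; a2; a3].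

Definition not_ricci_eigenvalue f (a : R) : Prop :=
  forall phi, atlas phi -> forall p, chart_dom phi p ->
    ~~ eigenvalue (ricci_operator f phi p) a.

Definition ricci_multiplicity_notin f (a : R) (s : seq nat) : Prop :=
  forall phi, atlas phi -> forall p, chart_dom phi p ->
    multiplicity (ricci_operator f phi p) a \notin s.

End Hypersurfaces.

(* Main.v *)
Require Import Defs.
From mathcomp Require Import all_boot all_order all_algebra all_fingroup.
From mathcomp Require Import complex.
From mathcomp Require Import all_classical all_reals all_analysis.
From mathcomp Require Import ring lra zify.

(** The Gauss equation turns the theorem into a question about square roots.
    Let A be the shape operator and H its trace.  The Ricci operator is
    (n - 1) c + H A - A^2 ([ricci_gauss]), and A is diagonalizable because it
    is self-adjoint ([self_adjoint_diagonalizable]).  Let rho_i be the constant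
    Ricci eigenvalues and mu_i = rho_i - (n - 1) c.  At each point the
    principal curvatures can be numbered so that d_i^2 - H d_i + mu_i = 0, that
    is, d_i = (H + e_i sqrt (H^2 - 4 mu_i)) / 2 for signs e_i that may vary
    from point to point ([constant_ricci_branches]).  The sum over i is
    (n - 2) H + sum_i e_i sqrt (H^2 - 4 mu_i) = 0.

    If H were not constant, its values would fill an interval, because M is
    connected.  There are finitely many choices of signs, so a single choice
    satisfies the relation on a whole interval of values of H
    ([closed_cover_interval]).  The functions h and sqrt (h^2 - 4 t), for
    distinct t other than 0, are linearly independent on every interval
    ([branch_powers_sum_eq0], [power_sums_eq0]).  So the signs cancel within
    each class of indices with the same nonzero mu_i, and the signs of the
    class mu_i = 0 add up to n - 2 in absolute value.  Counting parities, the
    multiplicity of (n - 1) c is n or n - 2, and there is at most one other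
    Ricci eigenvalue ([branch_rigidity]); each of the three conditions excludes
    this.

    Hence H is constant.  For fixed x, det (x - A) then takes finitely many
    values, one for each choice of signs; it is continuous on M and does not
    depend on the chart, so it is constant.  This determines the principal
    curvatures with their multiplicities. *)

Set Implicit Arguments.
Unset Strict Implicit.
Unset Printing Implicit Defensive.
Import Order.TTheory GRing.Theory Num.Theory.
Import numFieldNormedType.Exports.

Local Open Scope classical_set_scope.
Local Open Scope ring_scope.

(** * Matrices that are self-adjoint for a positive definite form *)

Definition posdef (R : numDomainType) n (g : 'M[R]_n) :=
  forall v : 'rV[R]_n, v != 0 -> 0 < (v *m g *m v^T) 0 0.

Lemma posdef_unit (R : numFieldType) n (g : 'M[R]_n) : posdef g -> g \in unitmx.
Proof.
move=> pg; rewrite -row_free_unit; apply/row_freeP.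
case: (boolP (row_free g)) => [/row_freeP//|].
rewrite -kermx_eq0 => /rowV0Pn[v /sub_kermxP vg v0].
by have := pg v v0; rewrite vg mul0mx mxE ltxx.
Qed.

Lemma posdef_congr (R : numFieldType) n (g P : 'M[R]_n) :
  P \in unitmx -> posdef g -> posdef (P *m g *m P^T).
Proof.
move=> Pu pg v v0; have := pg (v *m P).
rewrite trmx_mul !mulmxA; apply.
by apply: contra_neq v0 => vP; rewrite -[v](mulmxK Pu) vP mul0mx.
Qed.

(** By induction on n, completing the square in the first coordinate: L clears
    the first row and column of g, and the Schur complement S that remains is
    again positive definite. *)
Lemma posdef_sqrt (R : rcfType) n (g : 'M[R]_n) :
  g^T = g -> posdef g ->
  exists2 P : 'M[R]_n, P \in unitmx & P *m g *m P^T = 1%:M.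
Proof.
elim: n g => [|n IHn] g gT pg.
  by exists 1%:M; [exact: unitmx1 | apply/matrixP => -[]].
rewrite -[n.+1]/(1 + n)%N in g gT pg *.
pose a := g 0 0.
have a0 : 0 < a.
  have := pg (delta_mx 0 0); rewrite -rowE trmx_delta -colE !mxE; apply.
  by apply/eqP => /matrixP/(_ 0 0); rewrite !mxE eqxx => /eqP; rewrite oner_eq0.
have ula : ulsubmx g = a%:M.
  by rewrite [LHS]mx11_scalar !mxE; congr (g _ _)%:M; apply: val_inj.
pose b := dlsubmx g.
have urb : ursubmx g = b^T by rewrite trmx_dlsub gT.
have gE : g = block_mx a%:M b^T b (drsubmx g) by rewrite -ula -urb submxK.
pose L : 'M[R]_(1 + n) := block_mx 1%:M 0 (- a^-1 *: b) 1%:M.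
have Lu : L \in unitmx.
  by rewrite unitmxE det_lblock !det1 mulr1 unitr1.
pose S := drsubmx (L *m g *m L^T).
have LgL : L *m g *m L^T = block_mx a%:M 0 0 S.
  rewrite -[LHS]submxK -/S; congr block_mx.
  - rewrite {1}gE /L tr_block_mx !mulmx_block !block_mxKul.
    by rewrite !(mul0mx, mulmx0, mul1mx, mulmx1, trmx1, trmx0, addr0).
  - rewrite {1}gE /L tr_block_mx !mulmx_block !block_mxKur.
    rewrite !(mul0mx, mulmx0, mul1mx, mulmx1, trmx1, trmx0, addr0).
    by rewrite linearZ /= mul_scalar_mx scalerA mulrN divff ?gt_eqF// scaleN1r addNr.
  - rewrite {1}gE /L tr_block_mx !mulmx_block !block_mxKdl.
    rewrite !(mul0mx, mulmx0, mul1mx, mulmx1, trmx1, trmx0, addr0).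
    by rewrite mul_mx_scalar scalerA mulrN divff ?gt_eqF// scaleN1r addNr.
have pLgL := posdef_congr Lu pg.
have [|v v0|Q Qu QS] := IHn S.
- by rewrite /S trmx_drsub !trmx_mul trmxK gT mulmxA.
- have := pLgL (row_mx 0 v); rewrite LgL tr_row_mx mul_row_block.
  rewrite !(mul0mx, mulmx0, add0r) mul_row_col mul0mx add0r; apply.
  by apply: contra_neq v0 => /(congr1 rsubmx); rewrite row_mxKr => ->; rewrite linear0.
exists (block_mx (Num.sqrt a)^-1%:M 0 0 Q *m L).
  rewrite unitmx_mul Lu andbT unitmxE det_lblock det_scalar1 unitrM -unitmxE Qu.
  by rewrite andbT unitfE invr_eq0 gt_eqF// sqrtr_gt0.
set D := block_mx _ _ _ _.
have -> : D *m L *m g *m (D *m L)^T = D *m (L *m g *m L^T) *m D^T.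
  by rewrite trmx_mul !mulmxA.
rewrite LgL /D.
rewrite tr_block_mx !mulmx_block !(mul0mx, mulmx0, trmx0, addr0, add0r).
rewrite QS tr_scalar_mx -!scalar_mxM mulrAC -expr2.
rewrite exprVn sqr_sqrtr ?ltW// mulVf ?gt_eqF//.
by rewrite -scalar_mx_block.
Qed.

(** The spectral theorem over the complex numbers gives a change of basis to a
    real diagonal matrix, and two real matrices that are similar over the
    complex numbers are similar over the reals. *)
Lemma realsym_diagonalizable (R : rcfType) n (S : 'M[R]_n) : S^T = S ->
  exists P (d : 'rV[R]_n), P \in unitmx /\ P *m S = diag_mx d *m P.
Proof.
move=> ST; pose toC : {rmorphism R -> R[i]} := real_complex R.
pose SC := map_mx toC S.
have realC p q (A : 'M[R]_(p, q)) : map_mx toC A \is a mxOver Num.real.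
  by apply/mxOverP => i j; rewrite mxE; apply/complex_realP; exists (A i j).
have exR p q (A : 'M[R[i]]_(p, q)) : A \is a mxOver Num.real ->
    exists B : 'M[R]_(p, q), A = map_mx toC B.
  move=> /mxOverP AR; exists (map_mx (@complex.Re R) A).
  by apply/matrixP => i j; rewrite !mxE /toC /= RRe_real.
have SCherm : SC \is hermsymmx.
  apply: realsym_hermsym; last exact: realC.
  by apply/is_hermitianmxP; rewrite expr0 scale1r map_mx_id // /SC map_trmx ST.
have /orthomx_spectralP SCE := hermitian_normalmx SCherm.
have [d dE] := exR _ _ _ (hermitian_spectral_diag_real SCherm).
have Uu := spectral_unit SC.
have [] := @real_similar _ _ SC (map_mx toC (diag_mx d)).
- exists (spectralmx SC) => //; apply/similarP => //.
  rewrite map_diag_mx -dE.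
  by move: SCE => /(congr1 (mulmx (spectralmx SC))); rewrite !mulmxA mulmxV ?mul1mx.
- exact: realC.
- exact: realC.
move=> P /andP[/= PR Pu] /(similarP Pu) PSC.
have [Q QE] := exR _ _ _ PR.
exists Q, d; split; first by rewrite -(map_unitmx toC) -QE.
by apply: (map_mx_inj (f := toC)); rewrite !map_mxM /= -QE.
Qed.

(** In a basis that is orthonormal for g, the operator h g^-1 has the symmetric
    matrix P h P^T. *)
Lemma self_adjoint_diagonalizable (R : rcfType) n (g h : 'M[R]_n) :
  g^T = g -> posdef g -> h^T = h ->
  exists P (d : 'rV[R]_n),
    P \in unitmx /\ P *m (h *m invmx g) = diag_mx d *m P.
Proof.
move=> gT pg hT.
have [P Pu PgP] := posdef_sqrt gT pg.
have PTu : P^T \in unitmx by rewrite unitmx_tr.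
have gE : invmx g = P^T *m P.
  have gu := posdef_unit pg.
  apply: (can_inj (mulKmx gu)); rewrite mulmxV//.
  apply: (can_inj (mulKmx Pu)); apply: (can_inj (mulmxK PTu)).
  by rewrite !mulmxA PgP mul1mx mulmx1.
have [|Q [d [Qu QE]]] := @realsym_diagonalizable _ _ (P *m h *m P^T).
  by rewrite !trmx_mul trmxK hT mulmxA.
exists (Q *m P), d; split; first by rewrite unitmx_mul Qu.
by rewrite gE !mulmxA -[RHS]/(_ *m _) -QE !mulmxA.
Qed.


(** Deleting the zero rows and columns leaves an invertible diagonal matrix; M
    is the matrix of this selection. *)
Lemma mxrank_diag (F : fieldType) n (e : 'rV[F]_n) :
  \rank (diag_mx e) = #|[pred i | e 0 i != 0]|.
Proof.
set K := [pred i | _]; pose j (k : 'I_#|K|) : 'I_n := enum_val k.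
pose M : 'M[F]_(#|K|, n) := \matrix_(k, i) (i == j k)%:R.
have MeE : M *m diag_mx e = \matrix_(k, i) ((i == j k)%:R * e 0 (j k)).
  apply/matrixP => k i; rewrite mul_mx_diag !mxE.
  by case: eqP => [->//|]; rewrite !mul0r.
apply/eqP; rewrite eqn_leq; apply/andP; split.
  have -> : diag_mx e = diag_mx e *m M^T *m M.
    apply/matrixP => i i'; rewrite mul_diag_mx !mxE.
    case: (boolP (i \in K)) => [iK|].
      rewrite (bigD1 (enum_rank_in iK i)) //= big1 => [|k kn].
        rewrite !mxE /j enum_rankK_in// eqxx mulr1 addr0 eq_sym.
        by case: eqP; rewrite ?mulr1 ?mulr0.
      rewrite !mxE; case: eqP => [ik|]; last by rewrite mulr0 mul0r.
      by case/eqP: kn; apply: enum_val_inj; rewrite enum_rankK_in.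
    rewrite inE negbK => /eqP ei; rewrite ei mul0rn big1 // => k _.
    by rewrite !mxE ei mul0r mul0r.
  exact: leq_trans (mxrankM_maxr _ _) (rank_leq_row _).
have MM : M *m diag_mx e *m M^T = diag_mx (\row_k e 0 (j k)).
  apply/matrixP => k k'; rewrite MeE !mxE (bigD1 (j k)) //= big1 => [|i ij].
    rewrite !mxE eqxx mul1r addr0 (inj_eq enum_val_inj).
    by case: eqP => [->|]; rewrite ?mulr1 ?mulr0.
  by rewrite !mxE (negbTE ij) !mul0r.
have Uu : diag_mx (\row_k e 0 (j k)) \in unitmx.
  rewrite unitmxE det_diag unitfE; apply/prodf_neq0 => k _.
  by rewrite mxE; have := enum_valP k; rewrite inE.
rewrite -[X in (X <= _)%N](mxrank_unit Uu) -MM.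
exact: leq_trans (mxrankM_maxl _ _) (mxrankM_maxr _ _).
Qed.

Lemma rank_eigenspace_diag (F : fieldType) n (A P : 'M[F]_n) (d : 'rV[F]_n) a :
  P \in unitmx -> P *m A = diag_mx d *m P ->
  \rank (eigenspace A a) = #|[pred i | d 0 i == a]|.
Proof.
move=> Pu PA; rewrite /eigenspace mxrank_ker.
have E : P *m (A - a%:M) = diag_mx (\row_i (d 0 i - a)) *m P.
  rewrite mulmxBr PA scalar_mxC -mulmxBl; congr (_ *m P).
  by apply/matrixP => i k; rewrite !mxE; case: eqP; rewrite ?mulr1n ?mulr0n ?subr0.
have -> : \rank (A - a%:M) = \rank (diag_mx (\row_i (d 0 i - a))).
  by rewrite -(eqmxMfull (A - a%:M) (_ : row_full P)) ?E ?mxrankMfree ?row_free_unit ?row_full_unit.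
rewrite mxrank_diag (_ : #|[pred i | _]| = #|[predC [pred i | d 0 i == a]]|).
  by rewrite -{1}(card_ord n) -(cardC [pred i | d 0 i == a]) addnK.
by apply: eq_card => i; rewrite !inE mxE subr_eq0.
Qed.

Lemma det_sub_similar_diag (F : fieldType) n (A P : 'M[F]_n) (d : 'rV[F]_n) :
  P \in unitmx -> P *m A = diag_mx d *m P ->
  forall x, \det (x%:M - A) = \prod_i (x - d 0 i).
Proof.
move=> Pu PA x.
have : P *m (x%:M - A) = diag_mx (\row_i (x - d 0 i)) *m P.
  rewrite mulmxBr PA scalar_mxC -mulmxBl; congr (_ *m P).
  by apply/matrixP => i k; rewrite !mxE; case: eqP; rewrite ?mulr1n ?mulr0n ?subr0.
move=> /(congr1 determinant); rewrite !det_mulmx mulrC det_diag.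
have dP : \det P != 0 by rewrite -unitfE -unitmxE.
by move=> /(mulIf dP) ->; apply: eq_bigr => i _; rewrite mxE.
Qed.

Lemma count_mem_codom (T : eqType) n (h : 'I_n -> T) a :
  count_mem a (codom h) = #|[pred i | h i == a]|.
Proof.
rewrite /codom /image_mem count_map cardE -size_filter; congr size.
by rewrite -filter_predI; apply: eq_filter => i; rewrite /= andbT.
Qed.

(** Two polynomials with the same values on an infinite field are equal, so
    they have the same roots with the same multiplicities. *)
Lemma card_eq_of_prod_sub_eq (F : numFieldType) n (d e : 'I_n -> F) :
  (forall x, \prod_i (x - d i) = \prod_i (x - e i)) ->
  forall a, #|[pred i | d i == a]| = #|[pred i | e i == a]|.
Proof.
move=> de a.
have E : \prod_(z <- codom d) ('X - z%:P) = \prod_(z <- codom e) ('X - z%:P).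
  set p := LHS; set q := RHS; apply/eqP; rewrite -subr_eq0.
  pose rs := [seq k%:R : F | k <- iota 0 (size (p - q)).+1].
  apply/eqP/(@roots_geq_poly_eq0 _ _ rs).
  - apply/allP => _ /mapP[k _ ->]; apply/rootP; rewrite hornerD hornerN.
    rewrite !horner_prod !big_image /=.
    under eq_bigr do rewrite !hornerE.
    under [X in _ - X]eq_bigr do rewrite !hornerE.
    by rewrite de subrr.
  - by rewrite map_inj_uniq ?iota_uniq //; apply: mulrIn; rewrite oner_eq0.
  - by rewrite size_map size_iota.
have /seq.permP/(_ (pred1 a)) := prod_XsubC_eq E.
by rewrite !count_mem_codom.
Qed.

(** * Linear independence of the branches of a square root *)

Section Branches.
Variable R : realType.
Implicit Types a b x : R.

(** A finite form of the Baire category theorem. If the first closed set misses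
    a point of the interval, it misses a whole subinterval, and the induction
    continues there with one set fewer. *)
Lemma closed_cover_interval (T : eqType) (s : seq T) (Z : T -> set R) a b :
  (forall e, closed (Z e)) -> a < b ->
  (forall x, a < x < b -> exists2 e, e \in s & Z e x) ->
  exists e a' b', [/\ a <= a', a' < b', b' <= b &
    forall x, a' < x < b' -> Z e x].
Proof.
move=> Zc; elim: s a b => [|e s IHs] a b ab cov.
  by have [|e] := cov ((a + b) / 2); [apply/andP; split; lra|].
have [sub|] := pselect (forall x, a < x < b -> Z e x).
  by exists e, a, b; split.
move=> /existsNP[x /not_implyP[/andP[ax xb] Zx]].
have /nbhs_ballP[r /= r0 xr] : nbhs x (~` Z e).
  by apply: open_nbhs_nbhs; split => //; exact: closed_openC.
pose a' := Num.max a (x - r); pose b' := Num.min b (x + r).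
have aa' : a <= a' by rewrite le_max lexx.
have bb' : b' <= b by rewrite ge_min lexx.
have a'b' : a' < b'.
  rewrite gt_max !lt_min (lt_trans ax xb) /=; apply/and3P; split; lra.
have [y /andP[a'y yb']|f [c [d [ac cd db cdZ]]]] := IHs a' b' a'b'.
  have [f] := cov y (introT andP (conj (le_lt_trans aa' a'y) (lt_le_trans yb' bb'))).
  rewrite in_cons => /predU1P[->|fs] Zy; last by exists f.
  have : ball x r y.
    rewrite -ball_normE /= ltr_norml; move: a'y yb'.
    by rewrite gt_max lt_min => /andP[_ ?] /andP[_ ?]; apply/andP; split; lra.
  by move=> /xr.
by exists f, c, d; split => //; [exact: le_trans ac | exact: le_trans bb'].
Qed.

Lemma avoid_interval (s : seq R) a b : a < b ->
  exists b', [/\ a < b', b' <= b & forall x, a < x < b' -> x \notin s].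
Proof.
elim: s b => [|y s IHs] b ab; first by exists b; split.
have [c [ac cb cs]] := IHs b ab.
have [/andP[ay yc]|nay] := boolP (a < y < c).
  exists y; split => //; first exact: le_trans (ltW yc) cb.
  move=> x /andP[ax xy]; rewrite in_cons negb_or lt_eqF//= cs//.
  by rewrite ax (lt_trans xy).
exists c; split => // x xac; rewrite in_cons negb_or cs// andbT.
by apply: contraNneq nay => <-.
Qed.

(** Both y = id and y = sqrt (x^2 - a) satisfy y' = x / y. For such y the
    derivative of y^(1 - 2k) is again a multiple of y^(1 - 2(k+1)), by a factor
    that does not depend on a. *)
Lemma is_derive_branch_power (y : R -> R) k x : y x != 0 ->
  is_derive x 1 y (x / y x) ->
  is_derive x 1 (fun t => y t * (y t)^-1 ^+ (2 * k))
    ((1 - (2 * k)%:R) * x * (y x * (y x)^-1 ^+ (2 * k.+1))).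
Proof.
move=> yx0 dy.
have dv : is_derive x 1 (fun t => (y t)^-1) (- (y x)^-2 * (x / y x)).
  apply: DeriveDef; first exact: derivableV.
  by rewrite deriveV //= derive_val.
have -> : (fun t => y t * (y t)^-1 ^+ (2 * k)) =
    y * (fun t => (y t)^-1) ^+ (2 * k).
  by apply/funext => t; rewrite !fctE.
apply: is_derive_eq.
rewrite !fctE /GRing.scale /= mulnS addnC exprD.
set v := (y x)^-1; have vy : v * y x = 1 by rewrite mulVf.
have pw : (2 * k)%:R * v ^+ (2 * k).-1 * v = (2 * k)%:R * v ^+ (2 * k).
  case: (k) => [|l]; first by rewrite muln0 !mul0r.
  by rewrite mulnS add2n /= -mulrA -exprSr.
rewrite -exprVn -/v mulrA [y x * _]mulrC.
set w := v ^+ (2 * k) in pw *; set p := (2 * k)%:R in pw *.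
set w' := v ^+ (2 * k).-1 in pw *.
transitivity (- (p * w' * v * (v * y x) * (x * v)) + w * (x * v)); first by ring.
transitivity ((1 - p) * x * (w * v * (v * y x))); last by ring.
by rewrite pw vy; ring.
Qed.

(** A linear relation between the functions y_i can be differentiated, and the
    common factor (1 - 2k) x divided out, to give the same relation between the
    functions y_i^(1 - 2k). *)
Lemma branch_powers_sum_eq0 m (c : 'I_m -> R) (y : 'I_m -> R -> R) a b :
  (forall x, a < x < b -> x != 0) ->
  (forall i x, a < x < b -> y i x != 0) ->
  (forall i x, a < x < b -> is_derive x 1 (y i) (x / y i x)) ->
  (forall x, a < x < b -> \sum_i c i * y i x = 0) ->
  forall k x, a < x < b -> \sum_i c i * (y i x * (y i x)^-1 ^+ (2 * k)) = 0.
Proof.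
move=> x0 y0 dy sum0; elim=> [|k IHk] x xab.
  by under eq_bigr do rewrite expr0 mulr1; exact: sum0.
pose F t := \sum_i c i * (y i t * (y i t)^-1 ^+ (2 * k)).
have dF : is_derive x 1 F
    ((1 - (2 * k)%:R) * x * \sum_i c i * (y i x * (y i x)^-1 ^+ (2 * k.+1))).
  have -> : F = \sum_i (fun t => c i *: (y i t * (y i t)^-1 ^+ (2 * k))).
    by apply/funext => t; rewrite fct_sumE.
  rewrite mulr_sumr; apply: is_derive_eq.
    apply: is_derive_sum => i; apply: is_deriveZ.
    by apply: is_derive_branch_power; [exact: y0 | exact: dy].
  by apply: eq_bigr => i _; rewrite /GRing.scale /=; ring.
have : 'D_1 F x = 0.
  rewrite -(derive_cst (0 : R) x (1 : R)); apply: near_eq_derive.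
  have : x \in `]a, b[ by rewrite in_itv.
  move=> /near_in_itvoo; apply: filterS => t; rewrite in_itv => tab.
  by rewrite /F IHk.
rewrite derive_val => /eqP; rewrite !mulf_eq0 (negbTE (x0 _ xab)) orbF.
case: eqP => [/eqP|_ /eqP//]; rewrite subr_eq0 eq_sym pnatr_eq1.
by case: k {IHk F dF} => [|k]; rewrite ?muln0// mulnS.
Qed.

(** A Vandermonde argument in which nodes may coincide: the relations extend to
    sum_i w_i p (z_i) = 0 for every polynomial p, and p is chosen to vanish at
    all nodes other than t. *)
Lemma power_sums_eq0 m (w z : 'I_m -> R) :
  (forall k, \sum_i w i * z i ^+ k = 0) ->
  forall t, \sum_(i | z i == t) w i = 0.
Proof.
move=> wz t.
have wp (p : {poly R}) : \sum_i w i * p.[z i] = 0.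
  under eq_bigr do rewrite horner_coef mulr_sumr.
  rewrite exchange_big big1 //= => k _.
  under eq_bigr do rewrite mulrCA.
  by rewrite -mulr_sumr wz mulr0.
pose p := \prod_(s <- codom z | s != t) ('X - s%:P).
have pE : p = \prod_(s <- [seq s <- codom z | s != t]) ('X - s%:P).
  by rewrite big_filter.
have pz i : (p.[z i] == 0) = (z i != t).
  by rewrite -/(root p (z i)) pE root_prod_XsubC mem_filter codom_f andbT.
have pt : p.[t] != 0.
  by rewrite -/(root p t) pE root_prod_XsubC mem_filter eqxx.
have := wp p; rewrite (bigID (fun i => z i == t)) /= [X in _ + X]big1 => [|i zi].
  rewrite addr0; under eq_bigr => i /eqP -> do [].
  by rewrite -mulr_suml => /eqP; rewrite mulf_eq0 (negbTE pt) orbF => /eqP.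
by move: zi; rewrite -pz => /eqP ->; rewrite mulr0.
Qed.

(** For N = n - 2 this vanishes when x is the trace of the shape operator and
    the e_i are the signs of its principal curvatures ([curvature_branch]). *)
Definition branch_sum n (mu : 'I_n -> R) (e : 'I_n -> bool) (N x : R) : R :=
  N * x + \sum_i (-1) ^+ e i * Num.sqrt (x ^+ 2 - 4 * mu i).

(** The squares of the branches h and sqrt (h^2 - 4 mu_i) are h^2 and h^2 - 4
    mu_i. Their inverses are the nodes to which [power_sums_eq0] applies: two
    of them coincide exactly when the mu_i do, where h counts as a branch with
    mu = 0. The sign s is that of h, because sqrt (h^2) = |h|. *)
Lemma branch_sum_class n (mu : 'I_n -> R) (e : 'I_n -> bool) (N a b : R) :
  a < b ->
  (forall x i, a < x < b -> 0 <= x ^+ 2 - 4 * mu i) ->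
  (forall x, a < x < b -> branch_sum mu e N x = 0) ->
  (forall t, t != 0 -> \sum_(i | mu i == t) (-1) ^+ e i = 0 :> R) /\
  (exists s : bool, N + (-1) ^+ s * \sum_(i | mu i == 0) (-1) ^+ e i = 0).
Proof.
move=> ab disc F0.
(* Away from these points all the branches are differentiable and nonzero. *)
pose bad := 0 :: codom (fun i => Num.sqrt (4 * mu i))
              ++ codom (fun i => - Num.sqrt (4 * mu i)).
have [b' [ab' b'b good]] := avoid_interval bad ab.
have sub x : a < x < b' -> a < x < b.
  by move=> /andP[-> xb]; exact: lt_le_trans xb b'b.
have x0 x : a < x < b' -> x != 0.
  by move=> /good; rewrite in_cons negb_or => /andP[].
have disc0 x i : a < x < b' -> 0 < x ^+ 2 - 4 * mu i.
  move=> xab; rewrite lt_neqAle disc ?sub// andbT eq_sym subr_eq0.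
  apply/eqP => xmu; have := good x xab; apply/negP; rewrite negbK in_cons mem_cat.
  have -> : x \in codom (fun i => Num.sqrt (4 * mu i)) = (x == `|x|) ||
     (x \in codom (fun i => Num.sqrt (4 * mu i))).
    by case: eqP => // xx; rewrite xx -sqrtr_sqr xmu codom_f.
  have [x_ge0|x_lt0] := leP 0 x; first by rewrite (ger0_norm x_ge0) eqxx !orbT.
  have -> : x = - Num.sqrt (4 * mu i) by rewrite -xmu sqrtr_sqr ltr0_norm// opprK.
  by rewrite (codom_f (fun i => - Num.sqrt (4 * mu i))) !orbT.
(* Index 0 stands for the branch h, with coefficient N. *)
pose y (j : 'I_n.+1) (x : R) :=
  if unlift ord0 j is Some i then Num.sqrt (x ^+ 2 - 4 * mu i) else x.
pose c (j : 'I_n.+1) : R := if unlift ord0 j is Some i then (-1) ^+ e i else N.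
have y0 j x : a < x < b' -> y j x != 0.
  rewrite /y; case: unlift => [i|]; last exact: x0.
  by move=> /disc0 d; rewrite gt_eqF// sqrtr_gt0.
have dy j x : a < x < b' -> is_derive x 1 (y j) (x / y j x).
  move=> xab; rewrite /y; case: unlift => [i|]; last first.
    by rewrite divff ?x0//; exact: is_derive_id.
  have di := disc0 _ i xab.
  have d1 : is_derive x 1 (fun t : R => t ^+ 2 - 4 * mu i) (2 * x).
    apply: is_derive_eq.
    by rewrite /GRing.scale /= subr0; ring.
  have d2 := is_derive1_sqrt di.
  have d3 := @is_derive1_comp _ Num.sqrt (fun t => t ^+ 2 - 4 * mu i) _ _ _ d2 d1.
  apply: (is_derive_eq d3).
  have r0 : Num.sqrt (x ^+ 2 - 4 * mu i) != 0 by rewrite gt_eqF// sqrtr_gt0.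
  by rewrite /GRing.scale /=; field.
have sum0 x : a < x < b' -> \sum_j c j * y j x = 0.
  move=> xab; rewrite big_ord_recl /c /y unlift_none.
  under eq_bigr do rewrite liftK.
  exact: F0 (sub _ xab).
have [x xab] : exists x, a < x < b' by exists ((a + b') / 2); apply/andP; split; lra.
have pw k : \sum_j (c j * y j x) * ((y j x)^-1 ^+ 2) ^+ k = 0.
  under eq_bigr do rewrite -exprM -mulrA.
  by apply: branch_powers_sum_eq0 xab.
have eqd s t : (x ^+ 2 - 4 * s == x ^+ 2 - 4 * t) = (s == t).
  by apply/eqP/eqP => [?|->//]; lra.
have class t : 0 < x ^+ 2 - 4 * t ->
    (if 0 == t then N * x else 0) +
    (\sum_(i | mu i == t) (-1) ^+ e i) * Num.sqrt (x ^+ 2 - 4 * t) = 0.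
  move=> t0; rewrite -{}[RHS](power_sums_eq0 pw (x ^+ 2 - 4 * t)^-1).
  rewrite [RHS]big_mkcond big_ord_recl /= /c /y unlift_none; congr (_ + _).
    by rewrite exprVn (inj_eq invr_inj) -eqd mulr0 subr0.
  rewrite mulr_suml big_mkcond; apply: eq_bigr => i _; rewrite liftK.
  rewrite exprVn (inj_eq invr_inj) sqr_sqrtr ?ltW ?disc0// eqd.
  by case: eqP => // ->.
split=> [t t0|].
  have [/existsP[i /eqP it]|no] := boolP [exists i, mu i == t]; last first.
    by rewrite big1// => i it; case/existsP: no; exists i.
  have d0 : 0 < x ^+ 2 - 4 * t by rewrite -it disc0.
  have /eqP := class t d0; rewrite [0 == t]eq_sym (negbTE t0) add0r mulf_eq0 => /orP[/eqP//|].
  by rewrite gt_eqF// sqrtr_gt0.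
have := class 0; rewrite eqxx mulr0 subr0 sqrtr_sqr exprn_even_gt0//= x0//.
move=> /(_ isT); have [x_ge0|x_lt0] := leP 0 x => E.
  exists false; apply: (mulIf (x0 _ xab)).
  by rewrite mul0r -[RHS]E ger0_norm// expr0 mul1r mulrDl.
exists true; apply: (mulIf (x0 _ xab)).
by rewrite mul0r -[RHS]E ltr0_norm// expr1; ring.
Qed.

Lemma sum_sign (T : finType) (P : pred T) (e : T -> bool) :
  \sum_(i | P i) (-1) ^+ e i =
    #|[pred i | P i && ~~ e i]|%:R - #|[pred i | P i && e i]|%:R :> R.
Proof.
rewrite (bigID e) /= addrC; congr (_ + _).
  by under eq_bigr => i /andP[_ /negbTE ->] do []; rewrite sumr_const.
by under eq_bigr => i /andP[_ ->] do []; rewrite sumr_const expr1 mulNrn.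
Qed.

Lemma card_sign (T : finType) (P e : pred T) :
  #|[pred i | P i]| = (#|[pred i | P i && ~~ e i]| + #|[pred i | P i && e i]|)%N.
Proof.
rewrite addnC -(cardID e [pred i | P i]); congr addn.
by apply: eq_card => i; rewrite !inE andbC.
Qed.

(** One choice of signs is valid on a subinterval. The signs cancel in each
    class of a nonzero value of mu, so these classes have even size; in the
    class of 0 they add up to n - 2 in absolute value. This leaves at most two
    indices outside the class of 0, whereas two nonzero classes would contain
    at least four. *)
Lemma branch_rigidity n (mu : 'I_n -> R) a b : (3 <= n)%N -> a < b ->
  (forall x, a < x < b -> exists e : {ffun 'I_n -> bool},
     (forall i, 0 <= x ^+ 2 - 4 * mu i) /\ branch_sum mu e (n - 2)%:R x = 0) ->
  (#|[pred i | mu i == 0]| = n \/ #|[pred i | mu i == 0]| = (n - 2)%N) /\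
  (forall i j, mu i != 0 -> mu j != 0 -> mu i = mu j).
Proof.
move=> n3 ab H.
pose Z (e : {ffun 'I_n -> bool}) : set R := [set x | branch_sum mu e (n - 2)%:R x = 0].
have Zc e : closed (Z e).
  have -> : Z e = branch_sum mu e (n - 2)%:R @^-1` [set 0] by [].
  apply: closed_comp => [x _|]; last exact: closed_eq.
  apply: continuousD; first by apply: continuousM; [exact: cst_continuous | exact: id].
  apply: cvg_big => [|i _]; first exact: add_continuous.
  apply: cvgM; first exact: cvg_cst.
  apply: continuous_cvg; first exact: sqrt_continuous.
  by apply: cvgB; [exact: exprn_continuous | exact: cvg_cst].
have [|e [a' [b' [aa' ab' bb' eZ]]]] := @closed_cover_interval _ (enum {ffun 'I_n -> bool}) Z a b Zc ab.
  by move=> x /H[e [_ ?]]; exists e; rewrite ?mem_enum.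
have disc x i : a' < x < b' -> 0 <= x ^+ 2 - 4 * mu i.
  move=> /andP[ax xb]; have [|e' [d _]] := H x; last exact: d.
  by rewrite (le_lt_trans aa' ax) (lt_le_trans xb bb').
have [cl [s cl0]] := branch_sum_class ab' disc eZ.
have even_class t : t != 0 -> exists k, #|[pred i | mu i == t]| = (k + k)%N.
  move=> t0; exists #|[pred i | (mu i == t) && e i]|.
  rewrite (card_sign _ e); congr addn; apply/eqP.
  by rewrite -(eqr_nat R) -subr_eq0 -sum_sign cl.
have c0n : (#|[pred i | mu i == 0%R]| <= n)%N by rewrite -[leqRHS]card_ord max_card.
have zero_class : #|[pred i | mu i == 0%R]| = n \/ #|[pred i | mu i == 0%R]| = (n - 2)%N.
  move: cl0 c0n (card_sign (fun i => mu i == 0%R) e); rewrite sum_sign /=.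
  set m := #|_|; set p := #|_|; set q := #|_|; case: s => /= /eqP.
    rewrite expr1 mulN1r opprB addrA subr_eq0 -natrD eqr_nat => /eqP; lia.
  rewrite expr0 mul1r addrA subr_eq0 -natrD eqr_nat => /eqP; lia.
split=> // i j i0 j0; apply: contrapT => /eqP ij.
have [k kE] := even_class _ i0; have [l lE] := even_class _ j0.
have : (#|[pred k | mu k == 0%R]| + #|[pred k | mu k == mu i]| + #|[pred k | mu k == mu j]| <= n)%N.
  have cardE' t : #|[pred k | mu k == t]| = (\sum_k (mu k == t))%N.
    by rewrite -sum1_card big_mkcond; apply: eq_bigr => m _; case: ifP; rewrite inE => ->.
  rewrite !cardE' -!big_split -[leqRHS](card_ord n) -sum1_card leq_sum//= => m _.
  have [->|] := eqVneq (mu m) 0%R.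
    by rewrite eq_sym (negbTE i0) eq_sym (negbTE j0).
  by have [->|] := eqVneq (mu m) (mu i); rewrite ?(negbTE ij) // leq_b1.
have : (0 < #|[pred k | mu k == mu i]|)%N by apply/card_gt0P; exists i; rewrite inE.
have : (0 < #|[pred k | mu k == mu j]|)%N by apply/card_gt0P; exists j; rewrite inE.
lia.
Qed.
End Branches.

(** * Symmetry of second derivatives *)

Lemma dist_le_of_close (R : realType) (x y z e : R) :
  `|x - z| < e / 2 -> `|y - z| < e / 2 -> `|x - y| <= e.
Proof.
rewrite !ltr_norml ler_norml => /andP[? ?] /andP[? ?].
by apply/andP; split; lra.
Qed.

Section Clairaut.
Variables (R : realType) (V : normedModType R).
Implicit Types (G : V -> R) (u a b : V).

Lemma is_derive_line G u a (t : R) : derivable G (u + t *: a) a ->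
  is_derive t (1 : R) (fun s => G (u + s *: a)) ('D_a G (u + t *: a)).
Proof.
have E : (fun h : R => h^-1 *: (((fun s => G (u + s *: a)) \o shift t) (h *: 1) - G (u + t *: a))) =
    (fun h => h^-1 *: ((G \o shift (u + t *: a)) (h *: a) - G (u + t *: a))).
  apply/funext => h /=; rewrite [h *: 1](mulr1 h); congr (_ *: (G _ - _)).
  by rewrite scalerDl addrCA.
by move=> dG; apply: DeriveDef; rewrite /derivable /derive E.
Qed.

Lemma mvt_line G u a (h : R) : 0 < h ->
  (forall t, 0 <= t <= h -> derivable G (u + t *: a) a) ->
  exists2 t, 0 <= t <= h & G (u + h *: a) - G u = 'D_a G (u + t *: a) * h.
Proof.
move=> h0 dG; pose f s := G (u + s *: a).
have df t : 0 <= t <= h -> is_derive t (1 : R) f ('D_a G (u + t *: a)).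
  by move=> /dG; exact: is_derive_line.
have [| |c] := @MVT _ f (fun t => 'D_a G (u + t *: a)) 0 h h0.
- by move=> t; rewrite in_itv /= => /andP[t0 th]; apply: df; rewrite !ltW.
- apply: derivable_within_continuous => t; rewrite in_itv /= => th.
  by have := df t th; case.
rewrite in_itv /= => /andP[c0 ch] E; exists c; first by rewrite !ltW.
by move: E; rewrite subr0 /f scale0r addr0.
Qed.

(** The mean value theorem, first in the direction a for v |-> G (v + h b) - G
    v, then in the direction b for the derivative of G along a. *)
Lemma mvt_mixed G u a b (h : R) : 0 < h ->
  (forall s t, 0 <= s <= h -> 0 <= t <= h ->
     derivable G (u + s *: a + t *: b) a /\
     derivable ('D_a G) (u + s *: a + t *: b) b) ->
  exists s t, [/\ 0 <= s <= h, 0 <= t <= h &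
    G (u + h *: a + h *: b) - G (u + h *: a) - G (u + h *: b) + G u =
    'D_b ('D_a G) (u + s *: a + t *: b) * h ^+ 2].
Proof.
move=> h0 dG.
have h00 : (0 : R) <= 0 <= h by rewrite lexx ltW.
have hh0 : (0 : R) <= h <= h by rewrite lexx ltW.
pose phi v := G (v + h *: b) - G v.
have dphi v : derivable G (v + h *: b) a -> derivable G v a ->
    is_derive v a phi ('D_a G (v + h *: b) - 'D_a G v).
  move=> d1 d2.
  have dsh : is_derive v a (fun w => G (w + h *: b)) ('D_a G (v + h *: b)).
    have E : (fun k : R => k^-1 *: (((fun w => G (w + h *: b)) \o shift v) (k *: a) - G (v + h *: b))) =
      (fun k => k^-1 *: ((G \o shift (v + h *: b)) (k *: a) - G (v + h *: b))).
      by apply/funext => k /=; rewrite addrA.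
    by split; rewrite /derivable /derive E.
  exact: is_deriveB.
have [|s sh sE] := @mvt_line phi u a h h0.
  move=> t th.
  have [d1 _] := dG t h th hh0.
  have [d2 _] := dG t 0 th h00; rewrite scale0r addr0 in d2.
  by have := dphi _ d1 d2; case.
have [|t th tE] := @mvt_line ('D_a G) (u + s *: a) b h h0.
  by move=> t th; have [] := dG s t sh th.
exists s, t; split => //.
have [d1 _] := dG s h sh hh0.
have [d2 _] := dG s 0 sh h00; rewrite scale0r addr0 in d2.
have := dphi _ d1 d2 => dps; move: sE; rewrite derive_val tE /phi => E.
by rewrite expr2 mulrA -E; ring.
Qed.

(** The second difference of G over a small parallelogram is symmetric in its
    sides. By [mvt_mixed] it is h^2 times either mixed derivative at some point
    of the parallelogram, and both mixed derivatives are continuous at u. *)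
Lemma derive_comm G u a b :
  (\forall v \near u, derivable G v a /\ derivable ('D_a G) v b) ->
  (\forall v \near u, derivable G v b /\ derivable ('D_b G) v a) ->
  {for u, continuous ('D_b ('D_a G))} -> {for u, continuous ('D_a ('D_b G))} ->
  'D_b ('D_a G) u = 'D_a ('D_b G) u.
Proof.
move=> n1 n2 c1 c2; apply/eqP; rewrite -subr_eq0 -normr_le0; apply/ler_addgt0Pl => e e0.
rewrite addr0.
have e20 : 0 < e / 2 by rewrite divr_gt0.
have k1 : \forall v \near u, `|'D_b ('D_a G) u - 'D_b ('D_a G) v| < e / 2.
  by move/cvgrPdist_lt : c1; apply.
have k2 : \forall v \near u, `|'D_a ('D_b G) u - 'D_a ('D_b G) v| < e / 2.
  by move/cvgrPdist_lt : c2; apply.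
have /nbhs_ballP[r /= r0 H] : nbhs u [set v |
    ((derivable G v a /\ derivable ('D_a G) v b) /\
     (derivable G v b /\ derivable ('D_b G) v a)) /\
    (`|'D_b ('D_a G) u - 'D_b ('D_a G) v| < e / 2 /\
     `|'D_a ('D_b G) u - 'D_a ('D_b G) v| < e / 2)].
  exact: filterI (filterI n1 n2) (filterI k1 k2).
(* The parallelogram with sides h a and h b stays in the ball of radius r. *)
pose h := r / (2 * (1 + `|a| + `|b|)).
have D0 : 0 < 1 + `|a| + `|b| by rewrite -addrA ltr_pwDl// addr_ge0.
have h0 : 0 < h by rewrite divr_gt0// mulr_gt0.
have inb s t : 0 <= s <= h -> 0 <= t <= h -> ball u r (u + s *: a + t *: b).
  move=> /andP[s0 sh] /andP[t0 th]; rewrite -ball_normE /= -addrA opprD addrA subrr add0r normrN.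
  apply: le_lt_trans (ler_normD _ _) _; rewrite !normrZ !ger0_norm//.
  have -> : r = h * (2 * (1 + `|a| + `|b|)) by rewrite divfK// gt_eqF// mulr_gt0.
  have : s * `|a| <= h * `|a| by rewrite ler_wpM2r.
  have : t * `|b| <= h * `|b| by rewrite ler_wpM2r.
  have : 0 <= h * `|a| by rewrite mulr_ge0// ltW.
  have : 0 <= h * `|b| by rewrite mulr_ge0// ltW.
  lra.
have [|s [t [sh th E1]]] := @mvt_mixed G u a b h h0.
  by move=> s t sh th; have [[dd _] _] := H _ (inb s t sh th); exact: dd.
have [|s' [t' [sh' th' E2]]] := @mvt_mixed G u b a h h0.
  move=> s' t' sh' th'; have [[_ dd] _] := H _ (inb t' s' th' sh').
  by rewrite [u + _ + _]addrAC; exact: dd.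
have E : 'D_b ('D_a G) (u + s *: a + t *: b) = 'D_a ('D_b G) (u + t' *: a + s' *: b).
  have hn0 : h ^+ 2 != 0 by rewrite expf_neq0// gt_eqF.
  rewrite [u + _ + h *: a]addrAC [u + _ + t' *: a]addrAC in E2.
  have E3 := etrans (esym E1) (etrans (congr1 (+%R^~ (G u)) (addrAC _ _ _)) E2).
  exact: (mulIf hn0 E3).
have [_ [k3 _]] := H _ (inb s t sh th).
have [_ [_ k4]] := H _ (inb t' s' th' sh').
apply: (dist_le_of_close k3); rewrite E; exact: k4.
Qed.
End Clairaut.

(** * Derivatives of sums, products and matrix entries *)

Section Differentiability.
Variables (R : realType) (V : normedModType R).
Implicit Types u v : V.

Lemma differentiable_bigsum I (r : seq I) (P : pred I) (f : I -> V -> R) u :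
  (forall i, differentiable (f i) u) ->
  differentiable (fun v => \sum_(i <- r | P i) f i v) u.
Proof.
move=> df; elim: r => [|i r IHr].
  by under eq_fun do rewrite big_nil; exact: differentiable_cst.
under eq_fun do rewrite big_cons.
by case: (P i) => //; exact: differentiableD.
Qed.

Lemma differentiable_bigprod I (r : seq I) (P : pred I) (f : I -> V -> R) u :
  (forall i, differentiable (f i) u) ->
  differentiable (fun v => \prod_(i <- r | P i) f i v) u.
Proof.
move=> df; elim: r => [|i r IHr].
  by under eq_fun do rewrite big_nil; exact: differentiable_cst.
under eq_fun do rewrite big_cons.
by case: (P i) => //; exact: differentiableM.
Qed.

Lemma differentiable_det n (A : V -> 'M[R]_n) u :
  (forall i j, differentiable (fun v => A v i j) u) ->
  differentiable (fun v => \det (A v)) u.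
Proof.
move=> dA; rewrite /determinant; apply: differentiable_bigsum => s.
by apply: differentiableM; [exact: differentiable_cst | exact: differentiable_bigprod].
Qed.

Lemma differentiable_adj n (A : V -> 'M[R]_n) u i j :
  (forall i j, differentiable (fun v => A v i j) u) ->
  differentiable (fun v => (\adj (A v)) i j) u.
Proof.
move=> dA; under eq_fun do rewrite mxE /cofactor.
apply: differentiableM; first exact: differentiable_cst.
by apply: differentiable_det => k l; under eq_fun do rewrite !mxE.
Qed.

(** Agrees with [invmx] on invertible matrices, but is a single formula, so
    that its entries can be differentiated. *)
Definition cramer_inv n (A : 'M[R]_n) : 'M[R]_n := (\det A)^-1 *: \adj A.

Lemma invmx_cramer n (A : 'M[R]_n) : A \in unitmx -> invmx A = cramer_inv A.
Proof. by rewrite /invmx => ->. Qed.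

Lemma differentiable_cramer_inv n (A : V -> 'M[R]_n) u i j :
  (forall i j, differentiable (fun v => A v i j) u) -> A u \in unitmx ->
  differentiable (fun v => cramer_inv (A v) i j) u.
Proof.
move=> dA; rewrite unitmxE unitfE => Au.
under eq_fun do rewrite mxE.
apply: differentiableM; last exact: differentiable_adj.
by apply: differentiableV => //; exact: differentiable_det.
Qed.

Lemma differentiable_entry m n (A : V -> 'M[R]_(m.+1, n.+1)) u i j :
  differentiable A u -> differentiable (fun v => A v i j) u.
Proof.
by move=> dA; apply: (@differentiable_comp _ _ _ _ A (fun M => M i j)) => //; exact: differentiable_coord.
Qed.

Lemma derive_entry m n (A : V -> 'M[R]_(m, n)) u w i j :
  derivable A u w -> 'D_w (fun v => A v i j) u = ('D_w A u) i j.
Proof. by move=> dA; rewrite derive_mx// mxE. Qed.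

Lemma derive_add (f g : V -> R) u w :
  derivable f u w -> derivable g u w ->
  'D_w (fun v => f v + g v) u = 'D_w f u + 'D_w g u.
Proof. exact: deriveD. Qed.

Lemma derivable_bigsum I (r : seq I) (P : pred I) (f : I -> V -> R) u w :
  (forall i, derivable (f i) u w) ->
  derivable (fun v => \sum_(i <- r | P i) f i v) u w.
Proof.
move=> df; elim: r => [|i r IHr].
  by under eq_fun do rewrite big_nil; exact: derivable_cst.
under eq_fun do rewrite big_cons.
by case: (P i); [exact: (derivableD (df i) IHr) | exact: IHr].
Qed.

Lemma derive_bigsum I (r : seq I) (P : pred I) (f : I -> V -> R) u w :
  (forall i, derivable (f i) u w) ->
  'D_w (fun v => \sum_(i <- r | P i) f i v) u = \sum_(i <- r | P i) 'D_w (f i) u.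
Proof.
move=> df; elim: r => [|i r IHr].
  by under eq_fun do rewrite big_nil; rewrite big_nil derive_cst.
under eq_fun do rewrite big_cons.
rewrite big_cons; case: (P i); rewrite -IHr; last by [].
exact: (derive_add (df i) (@derivable_bigsum I r P f u w df)).
Qed.

Lemma derive_mul (f g : V -> R) u w :
  derivable f u w -> derivable g u w ->
  'D_w (fun v => f v * g v) u = 'D_w f u * g u + f u * 'D_w g u.
Proof.
move=> df dg; rewrite (deriveM df dg) /GRing.scale /= addrC.
by congr (_ + _); exact: mulrC.
Qed.

(** The sum of products is the right-hand side of [gauss_formula], paired with
    a fixed vector. *)
Lemma derive_sum_products m (G f : 'I_m -> V -> R) (h a g b : V -> R)
    (k : R) u w (f' : 'I_m -> R) (a' b' : R) :
  (forall p, derivable (G p) u w) -> (forall p, derivable (f p) u w) ->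
  derivable h u w -> derivable a u w -> derivable g u w -> derivable b u w ->
  (forall p, 'D_w (f p) u = f' p) -> 'D_w a u = a' -> 'D_w b u = b' ->
  'D_w (fun v => \sum_p G p v * f p v + h v * a v + k * (g v * b v)) u =
  \sum_p ('D_w (G p) u * f p u + G p u * f' p) +
  ('D_w h u * a u + h u * a') + k * ('D_w g u * b u + g u * b').
Proof.
move=> dG df dh da dg db fE aE bE.
pose S v := \sum_p G p v * f p v.
pose H v := h v * a v; pose L v := g v * b v; pose K v := k * L v.
have dM p : derivable (fun v => G p v * f p v) u w := derivableM (dG p) (df p).
have dS : derivable S u w := derivable_bigsum dM.
have dH : derivable H u w := derivableM dh da.
have dL : derivable L u w := derivableM dg db.
have dk : derivable (fun _ : V => k) u w := derivable_cst k u w.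
have dK : derivable K u w := derivableM dk dL.
have dSH : derivable (fun v => S v + H v) u w := derivableD dS dH.
have ES : 'D_w S u = \sum_p ('D_w (G p) u * f p u + G p u * f' p).
  rewrite /S (derive_bigsum _ _ dM).
  by apply: eq_bigr => p _; rewrite (derive_mul (dG p) (df p)) fE.
have EH : 'D_w H u = 'D_w h u * a u + h u * a' by rewrite -aE; exact: derive_mul.
have EL : 'D_w L u = 'D_w g u * b u + g u * b' by rewrite -bE; exact: derive_mul.
have EK : 'D_w K u = k * 'D_w L u.
  by rewrite /K (derive_mul dk dL) derive_cst mul0r add0r.
rewrite -ES -EH -EL -EK -(derive_add dS dH) -(derive_add dSH dK).
reflexivity.
Qed.

End Differentiability.

(** * The form of the ambient space *)

Section AmbientForm.
Variables (R : realType) (n : nat) (c : R).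
Local Notation B := (@ambient_form R n c).
Implicit Types x y z : 'rV[R]_n.+2.

Definition ambient_sign (k : 'I_n.+2) : R :=
  if (k == 0) && (c < 0) then -1 else 1.

Lemma ambient_formE x y : B x y = \sum_k ambient_sign k * (x 0 k * y 0 k).
Proof.
rewrite big_ord_recl /ambient_form /ambient_sign eqxx /=; congr (_ + _).
by apply: eq_bigr => i _; rewrite mul1r.
Qed.

Lemma ambient_formC x y : B x y = B y x.
Proof. by rewrite !ambient_formE; apply: eq_bigr => k _; rewrite [x 0 k * _]mulrC. Qed.

Lemma ambient_formDl x y z : B (x + y) z = B x z + B y z.
Proof.
by rewrite !ambient_formE -big_split; apply: eq_bigr => k _; rewrite mxE mulrDl mulrDr.
Qed.

Lemma ambient_formZl a x z : B (a *: x) z = a * B x z.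
Proof.
by rewrite !ambient_formE mulr_sumr; apply: eq_bigr => k _; rewrite mxE -mulrA mulrCA.
Qed.

Lemma ambient_form0l z : B 0 z = 0.
Proof. by rewrite -(scale0r 0) ambient_formZl mul0r. Qed.

Lemma ambient_form_suml I (r : seq I) (P : pred I) (f : I -> 'rV[R]_n.+2) z :
  B (\sum_(i <- r | P i) f i) z = \sum_(i <- r | P i) B (f i) z.
Proof.
elim/big_rec2: _ => [|i a b _ <-]; first exact: ambient_form0l.
exact: ambient_formDl.
Qed.

Lemma ambient_formZr a x z : B z (a *: x) = a * B z x.
Proof. by rewrite !(ambient_formC z) ambient_formZl. Qed.

Lemma ambient_form_sumr I (r : seq I) (P : pred I) (f : I -> 'rV[R]_n.+2) z :
  B z (\sum_(i <- r | P i) f i) = \sum_(i <- r | P i) B z (f i).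
Proof. by rewrite ambient_formC ambient_form_suml; apply: eq_bigr => i _; rewrite ambient_formC. Qed.

Lemma ambient_sign_neq0 k : ambient_sign k != 0.
Proof. by rewrite /ambient_sign; case: ifP => _; rewrite ?oppr_eq0 oner_eq0. Qed.

Lemma ambient_form_nondeg x (E : 'M[R]_n.+2) :
  E \in unitmx -> (forall k, B x (row k E) = 0) -> x = 0.
Proof.
move=> Eu xE; pose x' : 'rV[R]_n.+2 := \row_k (ambient_sign k * x 0 k).
have : E *m x'^T = 0.
  apply/matrixP => k l; rewrite ord1 mxE [RHS]mxE -[RHS](xE k) ambient_formE.
  by apply: eq_bigr => j _; rewrite !mxE mulrC mulrA.
move=> /(congr1 (mulmx (invmx E))); rewrite mulKmx// mulmx0 => x'0.
apply/rowP => k; move/matrixP/(_ k 0): x'0; rewrite !mxE => /eqP.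
by rewrite mulf_eq0 (negbTE (ambient_sign_neq0 k)) => /eqP.
Qed.

(** Only the hyperboloid needs an argument. Write x = (a, xs) and v = (b, vs),
    where |xs|^2 = a^2 + 1/c and xs.vs = a b. Expanding |a vs - b xs|^2 >= 0
    gives a^2 (|vs|^2 - b^2) >= - b^2 / c, and - 1/c is positive. *)
Lemma tangent_posdef x v : space_form c x -> space_form_tangent c x v ->
  v != 0 -> 0 < B v v.
Proof.
move=> xQ xv v0.
have sq_ge0 (I : finType) (f : I -> R) : 0 <= \sum_i f i * f i.
  by apply: sumr_ge0 => i _; rewrite -expr2 sqr_ge0.
have sq_eq0 (I : finType) (f : I -> R) : \sum_i f i * f i = 0 -> forall i, f i = 0.
  move=> /eqP; rewrite psumr_eq0 => [/allP s0 i|i _]; last by rewrite -expr2 sqr_ge0.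
  by have := s0 i (mem_index_enum i); rewrite -expr2 sqrf_eq0 => /eqP.
have v_eq0 : v 0 0 = 0 -> \sum_(i < n.+1) v 0 (lift ord0 i) * v 0 (lift ord0 i) = 0 -> False.
  move=> v00 /sq_eq0 vi; case/eqP: v0; apply/rowP => k; rewrite [RHS]mxE.
  by case: (unliftP ord0 k) => [i ->|-> //].
have [c_ge0|c_lt0] := leP 0 c.
  rewrite lt_neqAle /ambient_form ltNge c_ge0 /= mul1r addr_ge0 ?andbT//; last first.
    by rewrite -expr2 sqr_ge0.
  apply/eqP => /esym /eqP; rewrite paddr_eq0 -?expr2 ?sqr_ge0// sqrf_eq0.
  by move=> /andP[/eqP + /eqP]; exact: v_eq0.
move: xQ xv; rewrite /space_form /space_form_tangent /= lt_eqF//.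
rewrite /ambient_form c_lt0 => -[xx /(_ isT) x0].
set a := x 0 0 in x0 xx *; set b := v 0 0 in v_eq0 *.
set xs := (fun i : 'I_n.+1 => x 0 (lift ord0 i)).
set vs := (fun i : 'I_n.+1 => v 0 (lift ord0 i)).
have := sq_ge0 _ (fun i => a * vs i - b * xs i).
have -> : \sum_i (a * vs i - b * xs i) * (a * vs i - b * xs i) =
   a ^+ 2 * \sum_i vs i * vs i - 2 * a * b * \sum_i xs i * vs i + b ^+ 2 * \sum_i xs i * xs i.
  rewrite !mulr_sumr -sumrB -big_split; apply: eq_bigr => i _ /=; ring.
move: xx v_eq0 (sq_ge0 _ xs) (sq_ge0 _ vs).
rewrite -/(\sum_i xs i * xs i) -/(\sum_i vs i * vs i) -/(\sum_i xs i * vs i).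
set X := \sum_i xs i * xs i; set W := \sum_i vs i * vs i; set Y := \sum_i xs i * vs i.
clearbody X W Y a b; move=> xx v_eq0 X0 W0 H xv.
have k0 : c^-1 < 0 by rewrite invr_lt0.
have XE : X = a ^+ 2 + c^-1 by lra.
have YE : Y = a * b by lra.
rewrite XE YE in H.
have a2 : 0 < a ^+ 2 by rewrite exprn_gt0.
have H2 : - c^-1 * b ^+ 2 <= a ^+ 2 * (W - b ^+ 2) by nra.
have b2 : 0 <= b ^+ 2 by rewrite sqr_ge0.
have [b0|b0] := eqVneq b 0.
  rewrite b0 mul0r mulr0 add0r lt_neqAle W0 andbT.
  by apply/eqP => /esym; exact: v_eq0.
have b20 : 0 < b ^+ 2 by rewrite lt_neqAle b2 andbT eq_sym expf_neq0.
have : 0 < a ^+ 2 * (W - b ^+ 2) by apply: lt_le_trans H2; rewrite mulr_gt0// oppr_gt0.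
rewrite pmulr_rgt0// expr2; lra.
Qed.

End AmbientForm.

(** * Partial derivatives on an open set *)

Lemma partialE (R : realType) n (V : normedModType R) i (f : 'rV[R]_n -> V) u :
  partial i f u = 'D_(delta_mx 0 i) f u.
Proof. by []. Qed.

#[local] Opaque derive partial.


Section Germs.
Variables (R : realType) (n : nat) (U : set 'rV[R]_n).
Hypothesis oU : open U.

Lemma near_open u : U u -> \forall v \near u, U v.
Proof. by move=> Uu; apply: open_nbhs_nbhs. Qed.

Lemma near_eq_on (T : Type) (f g : 'rV[R]_n -> T) u :
  (forall v, U v -> f v = g v) -> U u -> \forall v \near u, f v = g v.
Proof. by move=> fg /near_open; apply: filterS. Qed.

Lemma partial_eq (V : normedModType R) (f g : 'rV[R]_n -> V) i u :
  (forall v, U v -> f v = g v) -> U u -> partial i f u = partial i g u.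
Proof. by move=> fg Uu; rewrite !partialE; apply/near_eq_derive/near_eq_on. Qed.

Lemma partial_eq_cst (V : normedModType R) (f : 'rV[R]_n -> V) a i u :
  (forall v, U v -> f v = a) -> U u -> partial i f u = 0.
Proof. by move=> fa Uu; rewrite (@partial_eq _ _ (cst a)) // !partialE derive_cst. Qed.

Lemma continuous_eq_on (V : normedModType R) (f g : 'rV[R]_n -> V) u :
  (forall v, U v -> f v = g v) -> U u ->
  {for u, continuous f} -> {for u, continuous g}.
Proof.
move=> fg Uu; rewrite /prop_for /continuous_at -(fg u Uu) => cf.
exact: cvg_trans (near_eq_cvg (near_eq_on fg Uu)) cf.
Qed.

Lemma derivable_eq_on (V : normedModType R) (f g : 'rV[R]_n -> V) u w :
  (forall v, U v -> f v = g v) -> U u -> derivable f u w -> derivable g u w.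
Proof. by move=> fg Uu; apply: near_eq_derivable; apply: filterS (near_open Uu). Qed.

(** [derive_comm] for each coordinate of X. *)
Lemma partial_comm m (X : 'rV[R]_n -> 'rV[R]_m.+1) i j u :
  smooth_on U X -> U u ->
  partial i (partial j X) u = partial j (partial i X) u.
Proof.
move=> sX Uu.
have dX v : U v -> differentiable X v by exact: (sX [::]).
have dX1 k v : U v -> differentiable (partial k X) v by exact: (sX [:: k]).
have dX2 k l v : U v -> differentiable (partial k (partial l X)) v.
  by exact: (sX [:: k; l]).
apply/rowP => k; pose G v := X v 0 k.
have G1 l v : U v -> (partial l X v) 0 k = partial l G v.
  by move=> Uv; rewrite !partialE derive_entry//; apply/diff_derivable/dX.
have G2 l l' v : U v -> (partial l (partial l' X) v) 0 k = partial l (partial l' G) v.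
  move=> Uv; rewrite -(partial_eq l (G1 l') Uv) !partialE derive_entry//.
  by apply/diff_derivable/dX1.
have dG l l' v : U v -> derivable G v (delta_mx 0 l) /\
    derivable (partial l G) v (delta_mx 0 l').
  move=> Uv; split; first by apply/diff_derivable/differentiable_entry/dX.
  apply: (derivable_eq_on (G1 l) Uv).
  by apply/diff_derivable/differentiable_entry/dX1.
have cG l l' : {for u, continuous (partial l (partial l' G))}.
  apply: (continuous_eq_on (G2 l l') Uu).
  by apply/differentiable_continuous/differentiable_entry/dX2.
apply: etrans (etrans (G2 i j u Uu) _) (esym (G2 j i u Uu)).
apply: (@derive_comm R 'rV[R]_n G u (delta_mx 0 j) (delta_mx 0 i)).
- by apply: filterS (near_open Uu) => v; apply: dG.
- by apply: filterS (near_open Uu) => v; apply: dG.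
- exact: cG.
- exact: cG.
Qed.

End Germs.

Section AmbientDerivative.
Variables (R : realType) (n p : nat) (c : R).
Local Notation B := (@ambient_form R n c).
Implicit Types X Y : 'rV[R]_p -> 'rV[R]_n.+2.

Lemma differentiable_ambient X Y u : differentiable X u -> differentiable Y u ->
  differentiable (fun v => B (X v) (Y v)) u.
Proof.
move=> dX dY; under eq_fun do rewrite ambient_formE.
apply: differentiable_bigsum => k.
apply: differentiableM; first exact: differentiable_cst.
by apply: differentiableM; exact: differentiable_entry.
Qed.

Lemma partial_ambient X Y u i : differentiable X u -> differentiable Y u ->
  partial i (fun v => B (X v) (Y v)) u =
  B (partial i X u) (Y u) + B (X u) (partial i Y u).
Proof.
move=> dX dY; have E : (fun v => B (X v) (Y v)) =
  (fun v => \sum_k ambient_sign c k * (X v 0 k * Y v 0 k)).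
  by apply/funext => v; rewrite ambient_formE.
have dXk k : derivable (fun v => X v 0 k) u (delta_mx 0 i).
  exact/diff_derivable/differentiable_entry.
have dYk k : derivable (fun v => Y v 0 k) u (delta_mx 0 i).
  exact/diff_derivable/differentiable_entry.
have dXY k : derivable (fun v => X v 0 k * Y v 0 k) u (delta_mx 0 i).
  exact: derivableM.
rewrite !partialE E derive_bigsum => [|k]; last first.
  by apply: derivableM => //; exact: derivable_cst.
rewrite !ambient_formE -big_split; apply: eq_bigr => k _ /=.
rewrite derive_mul; [|exact: derivable_cst|exact: dXY].
rewrite derive_cst mul0r add0r derive_mul// mulrDr.
rewrite !derive_entry//; exact/diff_derivable.
Qed.

End AmbientDerivative.

(** * The Gauss equation *)

(** The trace of the right-hand side of the Gauss equation, with G for the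
    inverse of g. *)
Lemma curvature_contraction (R : realType) n (h g G : 'M[R]_n) (c : R) j k :
  g *m G = 1%:M ->
  \sum_i \sum_m (h j k * h i m - h i k * h j m
     + c * (g j k * g i m - g i k * g j m)) * G m i =
  (\tr (h *m G) *: h - h *m G *m h + (n.-1%:R * c) *: g) j k.
Proof.
move=> gG.
have T (a : 'M[R]_n) : \sum_i \sum_m a i m * G m i = \tr (a *m G).
  by apply: eq_bigr => i _; rewrite mxE.
have Q (a : 'M[R]_n) : \sum_i \sum_m a j m * G m i * a i k = (a *m G *m a) j k.
  by rewrite mxE; apply: eq_bigr => i _; rewrite mxE mulr_suml.
transitivity (\sum_i \sum_m (h j k * (h i m * G m i) - h j m * G m i * h i k
    + c * (g j k * (g i m * G m i) - g j m * G m i * g i k))).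
  by apply: eq_bigr => i _; apply: eq_bigr => m _; ring.
under eq_bigr do rewrite big_split /= sumrB -!mulr_sumr sumrB -!mulr_sumr.
rewrite big_split /= sumrB -!mulr_sumr sumrB -!mulr_sumr !T !Q gG mxtrace1 mul1mx.
rewrite !mxE; have -> : n%:R = n.-1%:R + 1 :> R.
  by rewrite natr1 prednK// (leq_ltn_trans _ (ltn_ord j)).
ring.
Qed.

Section Gauss.
Variables (R : realType) (n : nat) (c : R) (U : set 'rV[R]_n).
Variables (F N : 'rV[R]_n -> 'rV[R]_n.+2).
Local Notation B := (@ambient_form R n c).
Hypotheses (oU : open U) (sF : smooth_on U F) (sN : smooth_on U N).
Hypothesis FQ : forall v, U v -> space_form c (F v).
Hypothesis Frank : forall v, U v -> row_free ('J F v).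
Hypothesis Ntan : forall v, U v -> space_form_tangent c (F v) (N v).
Hypothesis Nunit : forall v, U v -> B (N v) (N v) = 1.
Hypothesis Nnormal : forall v i, U v -> B (N v) (partial i F v) = 0.

(** [gram] and [sff] are the metric and the second fundamental form of one
    parametrization F with unit normal N. *)
Definition gram (v : 'rV[R]_n) : 'M[R]_n :=
  \matrix_(i, j) B (partial i F v) (partial j F v).
Definition sff (v : 'rV[R]_n) : 'M[R]_n :=
  \matrix_(i, j) - B (partial i N v) (partial j F v).

Let dF v : U v -> differentiable F v. Proof. exact: (sF [::]). Qed.
Let dF1 k v : U v -> differentiable (partial k F) v. Proof. exact: (sF [:: k]). Qed.
Let dF2 k l v : U v -> differentiable (partial k (partial l F)) v.
Proof. exact: (sF [:: k; l]). Qed.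
Let dN v : U v -> differentiable N v. Proof. exact: (sN [::]). Qed.
Let dN1 k v : U v -> differentiable (partial k N) v. Proof. exact: (sN [:: k]). Qed.

Lemma partial_const_form (X Y : 'rV[R]_n -> 'rV[R]_n.+2) a i v :
  (forall w, U w -> differentiable X w) -> (forall w, U w -> differentiable Y w) ->
  (forall w, U w -> B (X w) (Y w) = a) -> U v ->
  B (partial i X v) (Y v) = - B (X v) (partial i Y v).
Proof.
move=> dX dY XY Uv; apply/eqP; rewrite -addr_eq0 -partial_ambient; [|exact: dX|exact: dY].
by rewrite (partial_eq_cst oU i XY Uv).
Qed.

Lemma partial_entry_const (X : 'rV[R]_n -> 'rV[R]_n.+2) k a i v :
  (forall w, U w -> differentiable X w) ->
  (forall w, U w -> X w 0 k = a) -> U v -> (partial i X v) 0 k = 0.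
Proof.
move=> dX Xk Uv; rewrite !partialE -derive_entry; last exact/diff_derivable/dX.
exact: (partial_eq_cst oU i Xk Uv).
Qed.

(** Differentiate the relation <N, F_j> = 0. In this form the symmetry of the
    second fundamental form is that of second derivatives. *)
Lemma sffE v i j : U v -> sff v i j = B (partial i (partial j F) v) (N v).
Proof.
move=> Uv; rewrite mxE.
rewrite (@partial_const_form N (partial j F) 0)// ?opprK 1?ambient_formC//.
- exact: dF1.
- by move=> w Uw; exact: Nnormal.
Qed.

Lemma sff_sym v : U v -> (sff v)^T = sff v.
Proof.
move=> Uv; apply/matrixP => i j; rewrite mxE (sffE j i Uv) (sffE i j Uv).
by rewrite (partial_comm oU j i sF Uv).
Qed.

Lemma gram_sym v : (gram v)^T = gram v.
Proof. by apply/matrixP => i j; rewrite !mxE; exact: ambient_formC. Qed.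

Lemma immersion_tangent v i : U v -> space_form_tangent c (F v) (partial i F v).
Proof.
move=> Uv; rewrite /space_form_tangent /=; case: (eqVneq c 0) => [c0|c0].
  apply: (@partial_entry_const F 0 0) => // w /FQ.
  by rewrite /space_form /= c0 eqxx.
have FF w : U w -> B (F w) (F w) = c^-1.
  by move=> /FQ; rewrite /space_form /= (negbTE c0) => -[].
have := partial_const_form i dF dF FF Uv.
by rewrite ambient_formC => /eqP; rewrite -addr_eq0 -mulr2n mulrn_eq0 => /eqP.
Qed.

Lemma jacobian_row v i : U v -> row i ('J F v) = partial i F v.
Proof. by move=> Uv; rewrite rowE !partialE deriveEjacobian//; exact: dF. Qed.

Lemma mul_jacobian v (x : 'rV[R]_n) : U v ->
  x *m 'J F v = \sum_i x 0 i *: partial i F v.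
Proof.
by move=> Uv; rewrite mulmx_sum_row; apply: eq_bigr => i _; rewrite jacobian_row.
Qed.

Lemma gram_form v (x y : 'rV[R]_n) : U v ->
  (x *m gram v *m y^T) 0 0 = B (x *m 'J F v) (y *m 'J F v).
Proof.
move=> Uv; rewrite !mul_jacobian// ambient_form_suml mxE.
under eq_bigr do rewrite mxE mulr_suml.
rewrite exchange_big; apply: eq_bigr => i _ /=.
rewrite ambient_formZl ambient_form_sumr mulr_sumr; apply: eq_bigr => j _.
by rewrite !mxE ambient_formZr -mulrA [_ * y 0 j]mulrC.
Qed.

Lemma gram_posdef v : U v -> posdef (gram v).
Proof.
move=> Uv x x0; rewrite gram_form//; apply: (tangent_posdef (FQ Uv)).
  rewrite mul_jacobian//; have := fun i => immersion_tangent i Uv.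
  rewrite /space_form_tangent /=; case: ifP => _ Ft.
    by rewrite summxE big1// => i _; rewrite mxE Ft mulr0.
  by rewrite ambient_form_sumr big1// => i _; rewrite ambient_formZr Ft mulr0.
by apply: contra_neq x0 => xJ; apply: (row_free_inj (Frank Uv)); rewrite xJ mul0mx.
Qed.

Lemma gram_unit v : U v -> gram v \in unitmx.
Proof. by move=> /gram_posdef; exact: posdef_unit. Qed.

(** The normal direction of the space form itself: the position vector, or the
    first basis vector for the hyperplane that models c = 0. *)
Definition frame_normal v : 'rV[R]_n.+2 := if c == 0 then delta_mx 0 0 else F v.

Lemma ambient_form_delta0 x : c = 0 -> B x (delta_mx 0 0) = x 0 0.
Proof.
move=> c0; rewrite ambient_formE (bigD1 0)//= big1 => [|k k0].
  by rewrite /ambient_sign c0 ltxx andbF !mxE eqxx !mul1r mulr1 addr0.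
by rewrite !mxE (negbTE k0) andbF !mulr0.
Qed.

(** The tangent vectors F_i, N and [frame_normal] are n + 2 independent
    vectors, so they span the ambient space, whose form is nondegenerate. *)
Lemma frame_nondeg v (W : 'rV[R]_n.+2) : U v ->
  (forall i, B W (partial i F v) = 0) -> B W (N v) = 0 ->
  B W (frame_normal v) = 0 -> W = 0.
Proof.
move=> Uv WF WN WP; set P := frame_normal v in WP.
have B0 := ambient_form_delta0.
have PP : B P P != 0.
  rewrite /P /frame_normal; case: (eqVneq c 0) => c0.
    by rewrite B0// mxE eqxx oner_eq0.
  by have := FQ Uv; rewrite /space_form /= (negbTE c0) => -[-> _]; rewrite invr_eq0.
have NP : B (N v) P = 0.
  have := Ntan Uv; rewrite /P /frame_normal /space_form_tangent /=.
  by case: (eqVneq c 0) => c0; [rewrite B0 | rewrite ambient_formC].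
have FP i : B (partial i F v) P = 0.
  have := immersion_tangent i Uv; rewrite /P /frame_normal /space_form_tangent /=.
  by case: (eqVneq c 0) => c0; [rewrite B0 | rewrite ambient_formC].
(* The height 1 + 1 + n is convertible to n.+2, so E is a square matrix. *)
pose E : 'M[R]_(1 + 1 + n, n.+2) := col_mx (col_mx P (N v)) ('J F v).
have Eu : (E : 'M[R]_n.+2) \in unitmx.
  rewrite -row_free_unit -kermx_eq0; apply/eqP/row_matrixP => k; rewrite row0.
  have : row k (kermx E) *m E = 0 by apply/sub_kermxP; exact: row_sub.
  move: (row k _) => w; rewrite -[n.+2]/(1 + 1 + n)%N in w *.
  rewrite -[w]hsubmxK -[lsubmx w]hsubmxK.
  set p := lsubmx (lsubmx w); set q := rsubmx (lsubmx w); set x := rsubmx w.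
  rewrite /E !mul_row_col [p]mx11_scalar [q]mx11_scalar !mul_scalar_mx.
  move=> wE.
  have p0 : p 0 0 = 0.
    have := congr1 (B ^~ P) wE; rewrite !ambient_formDl !ambient_formZl NP mulr0 addr0.
    rewrite mul_jacobian// ambient_form_suml big1 => [|i _]; last first.
      by rewrite ambient_formZl FP mulr0.
    by rewrite addr0 ambient_form0l => /eqP; rewrite mulf_eq0 (negbTE PP) orbF => /eqP.
  have q0 : q 0 0 = 0.
    have := congr1 (B ^~ (N v)) wE; rewrite p0 scale0r add0r !ambient_formDl !ambient_formZl Nunit//.
    rewrite mul_jacobian// ambient_form_suml big1 => [|i _]; last first.
      by rewrite ambient_formZl ambient_formC Nnormal// mulr0.
    by rewrite addr0 ambient_form0l mulr1.
  have x0 : x = 0.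
    apply: (row_free_inj (Frank Uv)); move: wE.
    by rewrite p0 q0 !scale0r !add0r mul0mx.
  by rewrite p0 q0 x0 !raddf0 !row_mx0.
apply: (ambient_form_nondeg (c := c) Eu) => k.
rewrite -[n.+2]/(1 + 1 + n)%N in k *.
case: (split_ordP k) => [k' ->|k' ->]; last first.
  by rewrite rowKd jacobian_row// WF.
by rewrite rowKu; case: (split_ordP k') => [l ->|l ->]; rewrite ?rowKu ?rowKd row_id.
Qed.

Lemma differentiable_gram i j v : U v -> differentiable (fun w => gram w i j) v.
Proof.
move=> Uv; under eq_fun do rewrite mxE.
by apply: differentiable_ambient; exact: dF1.
Qed.

Lemma differentiable_sff i j v : U v -> differentiable (fun w => sff w i j) v.
Proof.
move=> Uv; under eq_fun do rewrite mxE.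
by apply: differentiableN; apply: differentiable_ambient; [exact: dN1 | exact: dF1].
Qed.

Lemma partial_gram l i j v : U v ->
  partial l (fun w => gram w i j) v =
  B (partial l (partial i F) v) (partial j F v) +
  B (partial i F v) (partial l (partial j F) v).
Proof.
move=> Uv; have -> : (fun w => gram w i j) = (fun w => B (partial i F w) (partial j F w)).
  by apply/funext => w; rewrite mxE.
by apply: partial_ambient; exact: dF1.
Qed.

(** The Koszul formula, with D1 and D2 for the first and second derivatives of
    F: all terms cancel except two equal ones. *)
Lemma koszul_sum (D2 : 'I_n -> 'I_n -> 'rV[R]_n.+2) (D1 : 'I_n -> 'rV[R]_n.+2) i j l :
  (forall a b, D2 a b = D2 b a) ->
  2^-1 * (B (D2 i j) (D1 l) + B (D1 j) (D2 i l) +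
          (B (D2 j i) (D1 l) + B (D1 i) (D2 j l)) -
          (B (D2 l i) (D1 j) + B (D1 i) (D2 l j))) = B (D2 i j) (D1 l).
Proof.
move=> D2C; rewrite (D2C j i) (D2C l i) (D2C l j) [B (D2 i l) _]ambient_formC.
by field.
Qed.

Lemma christoffelE k i j v : U v ->
  christoffel gram k i j v =
  \sum_l invmx (gram v) k l * B (partial i (partial j F) v) (partial l F v).
Proof.
move=> Uv; rewrite /christoffel mulr_sumr; apply: eq_bigr => l _.
rewrite mulrCA; congr (_ * _).
rewrite (partial_gram i j l Uv) (partial_gram j i l Uv) (partial_gram l i j Uv).
have : forall a b, partial a (partial b F) v = partial b (partial a F) v.
  by move=> a b; exact: (partial_comm oU a b sF Uv).
exact: (@koszul_sum _ (fun a => partial a F v)).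
Qed.

(** The Levi-Civita connection is the tangential part of the flat derivative.
    *)
Lemma christoffel_lower i j m v : U v ->
  \sum_k christoffel gram k i j v * gram v k m =
  B (partial i (partial j F) v) (partial m F v).
Proof.
(* The symbols with upper index are b g^-1, as a row vector. *)
move=> Uv; pose b : 'rV[R]_n := \row_l B (partial i (partial j F) v) (partial l F v).
have giT : (invmx (gram v))^T = invmx (gram v) by rewrite trmx_inv gram_sym.
have -> : B (partial i (partial j F) v) (partial m F v) = (b *m invmx (gram v) *m gram v) 0 m.
  by rewrite mulmxKV ?gram_unit// mxE.
rewrite mxE; apply: eq_bigr => k _; congr (_ * _).
rewrite (christoffelE _ _ _ Uv) mxE; apply: eq_bigr => l _.
by rewrite mulrC -[in LHS]giT !mxE.
Qed.

(** The difference of the two sides is orthogonal to F_i, N and [frame_normal];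
    [frame_nondeg] concludes. *)
Lemma gauss_formula j k v : U v ->
  partial j (partial k F) v =
  \sum_p christoffel gram p j k v *: partial p F v + sff v j k *: N v
  - (c * gram v j k) *: F v.
Proof.
move=> Uv; apply/eqP; rewrite -subr_eq0 opprB addrA; apply/eqP.
have FT i := immersion_tangent i Uv.
have cFF i : c * B (F v) (partial i F v) = 0.
  have := FT i; rewrite /space_form_tangent /=.
  by case: (eqVneq c 0) => [->|_ ->]; rewrite ?mul0r ?mulr0.
have cFN : c * B (F v) (N v) = 0.
  have := Ntan Uv; rewrite /space_form_tangent /=.
  by case: (eqVneq c 0) => [->|_ ->]; rewrite ?mul0r ?mulr0.
have BN x y : B (- x) y = - B x y by rewrite -scaleN1r ambient_formZl mulN1r.
apply: (frame_nondeg Uv) => [i||].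
- rewrite !(ambient_formDl, BN, ambient_formZl) ambient_form_suml.
  under eq_bigr do rewrite ambient_formZl.
  have -> : \sum_p christoffel gram p j k v * B (partial p F v) (partial i F v) =
     B (partial j (partial k F) v) (partial i F v).
    by rewrite -christoffel_lower//; apply: eq_bigr => p _; rewrite [gram v p i]mxE.
  rewrite (Nnormal i Uv) mulr0 addr0 mulrAC cFF mul0r addr0.
  exact: subrr.
- rewrite !(ambient_formDl, BN, ambient_formZl) ambient_form_suml.
  rewrite big1 => [|p _]; last by rewrite ambient_formZl ambient_formC Nnormal// mulr0.
  rewrite (Nunit Uv) mulr1 add0r mulrAC cFN mul0r addr0 sffE//.
  exact: subrr.
- rewrite /frame_normal; case: (eqVneq c 0) => c0.
    have z0 := ambient_form_delta0 ^~ c0.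
    have FT0 i w : U w -> (partial i F w) 0 0 = 0.
      by move=> Uw; have := immersion_tangent i Uw; rewrite /space_form_tangent /= c0 eqxx.
    have N0 : N v 0 0 = 0.
      by have := Ntan Uv; rewrite /space_form_tangent /= c0 eqxx.
    have -> : c * gram v j k = 0 by rewrite {1}c0 mul0r.
    rewrite scale0r addr0 ambient_formDl BN z0.
    rewrite (partial_entry_const j (dF1 k) (FT0 k) Uv) add0r.
    rewrite ambient_formDl ambient_formZl ambient_form_suml z0 N0 mulr0 addr0.
    rewrite big1 ?oppr0// => p _.
    by rewrite ambient_formZl z0 FT0// mulr0.
  have FF w : U w -> B (F w) (F w) = c^-1.
    by move=> /FQ; rewrite /space_form /= (negbTE c0) => -[].
  have FF1 i w : U w -> B (partial i F w) (F w) = 0.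
    move=> Uw; have := immersion_tangent i Uw.
    by rewrite /space_form_tangent /= (negbTE c0) ambient_formC.
  rewrite !(ambient_formDl, BN, ambient_formZl) ambient_form_suml.
  rewrite (partial_const_form j (dF1 k) dF (FF1 k) Uv) (FF _ Uv).
  rewrite big1 => [|p _]; last by rewrite ambient_formZl FF1// mulr0.
  have -> : B (N v) (F v) = 0.
    by have := Ntan Uv; rewrite /space_form_tangent /= (negbTE c0) ambient_formC.
  rewrite mulr0 addr0 oppr0 addr0 mulrAC mulfV// mul1r [gram v j k]mxE.
  by move: (partial j F v) (partial k F v) => x y; rewrite ambient_formC addNr.
Qed.

Lemma christoffel_cramer k i j v : U v ->
  christoffel gram k i j v =
  \sum_l cramer_inv (gram v) k l * B (partial i (partial j F) v) (partial l F v).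
Proof.
by move=> Uv; rewrite (christoffelE _ _ _ Uv) invmx_cramer// gram_unit.
Qed.

Lemma derivable_christoffel k i j v w : U v -> derivable (christoffel gram k i j) v w.
Proof.
move=> Uv.
have E u : U u -> \sum_l cramer_inv (gram u) k l *
    B (partial i (partial j F) u) (partial l F u) = christoffel gram k i j u.
  by move=> Uu; rewrite (christoffel_cramer _ _ _ Uu).
apply: (derivable_eq_on oU E Uv); apply: diff_derivable.
apply: differentiable_bigsum => l; apply: differentiableM.
  apply: differentiable_cramer_inv; last exact: gram_unit.
  by move=> a b; exact: differentiable_gram.
by apply: differentiable_ambient; [exact: dF2 | exact: dF1].
Qed.

(** Pair [gauss_formula] with the vector F_m (u), kept constant, and
    differentiate at u. The terms in which N or F is not differentiated vanish,
    because F_m (u) is tangent to the hypersurface. *)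
Lemma gauss_formula_derive i j k m u : U u ->
  \sum_p (partial i (christoffel gram p j k) u +
     \sum_q christoffel gram p i q u * christoffel gram q j k u) * gram u p m =
  B (partial i (partial j (partial k F)) u) (partial m F u) +
  sff u j k * sff u i m + c * (gram u j k * gram u i m).
Proof.
move=> Uu; pose Y := partial m F u.
have dY v : differentiable (fun _ : 'rV[R]_n => Y) v by exact: differentiable_cst.
have pY : partial i (fun _ : 'rV[R]_n => Y) u = 0 by rewrite partialE derive_cst.
have Bx0 x : B x 0 = 0 by rewrite ambient_formC ambient_form0l.
have dB (X : 'rV[R]_n -> 'rV[R]_n.+2) v : differentiable X v ->
    derivable (fun w => B (X w) Y) v (delta_mx 0 i).
  by move=> dX; apply: diff_derivable; exact: (differentiable_ambient c dX (dY v)).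
have pB (X : 'rV[R]_n -> 'rV[R]_n.+2) : differentiable X u ->
    partial i (fun w => B (X w) Y) u = B (partial i X u) Y.
  by move=> dX; rewrite (partial_ambient c i dX (dY u)) pY Bx0 addr0.
have E v : U v -> B (partial j (partial k F) v) Y =
    \sum_p christoffel gram p j k v * B (partial p F v) Y + sff v j k * B (N v) Y
    + - c * (gram v j k * B (F v) Y).
  move=> Uv; rewrite [in LHS](gauss_formula _ _ Uv) -scaleNr.
  rewrite !ambient_formDl !ambient_formZl ambient_form_suml !mulNr -mulrA.
  by congr (_ + _ - _); apply: eq_bigr => p _; rewrite ambient_formZl.
have cFY : c * B (F u) Y = 0.
  have := immersion_tangent m Uu; rewrite /space_form_tangent /=.
  by case: (eqVneq c 0) => [->|_ ->]; rewrite ?mul0r ?mulr0.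
have NY : B (N u) Y = 0 by exact: Nnormal.
have NiY : B (partial i N u) Y = - sff u i m by rewrite [sff u i m]mxE opprK.
have FY p : B (partial p F u) Y = gram u p m by rewrite [gram u p m]mxE.
have dGam p := @derivable_christoffel p j k u (delta_mx 0 i) Uu.
have dsff : derivable (fun v => sff v j k) u (delta_mx 0 i).
  by apply: diff_derivable; exact: differentiable_sff.
have dgram : derivable (fun v => gram v j k) u (delta_mx 0 i).
  by apply: diff_derivable; exact: differentiable_gram.
have dBF p : derivable (fun v => B (partial p F v) Y) u (delta_mx 0 i).
  by apply: dB; exact: dF1.
have dBN : derivable (fun v => B (N v) Y) u (delta_mx 0 i).
  by apply: dB; exact: dN.
have dBX : derivable (fun v => B (F v) Y) u (delta_mx 0 i).
  by apply: dB; exact: dF.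
have pBF p : partial i (fun v => B (partial p F v) Y) u =
    \sum_q christoffel gram q i p u * gram u q m.
  by rewrite (pB _ (dF1 p Uu)) (christoffel_lower i p m Uu).
have pBN : partial i (fun v => B (N v) Y) u = - sff u i m.
  by rewrite (pB _ (dN Uu)) NiY.
have pBX : partial i (fun v => B (F v) Y) u = gram u i m by rewrite (pB _ (dF Uu)).
have D := derive_sum_products (- c) dGam dBF dsff dBN dgram dBX pBF pBN pBX.
have := partial_eq oU i E Uu.
rewrite (pB _ (dF2 j k Uu)) [in RHS]partialE => E1.
have {E1 D} -> := etrans E1 D; rewrite NY.
have fin (x a b y z t w : R) : c * z = 0 ->
    x + (y * 0 + a * - b) + - c * (t * z + w) + a * b + c * w = x.
  move=> cz; transitivity (x - t * (c * z)); first by ring.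
  by rewrite cz mulr0 subr0.
apply: etrans (esym (fin _ _ _ _ _ _ _ cFY)).
under eq_bigr do rewrite mulrDl mulr_suml.
rewrite big_split [RHS]big_split; congr (_ + _).
  by apply: eq_bigr => p _; rewrite FY.
rewrite exchange_big; apply: eq_bigr => p _ /=.
rewrite mulr_sumr; apply: eq_bigr => q _.
by rewrite mulrAC mulrC.
Qed.

(** Exchange i and j in [gauss_formula_derive] and subtract: the third
    derivatives of F cancel, and the left-hand sides combine to the curvature
    tensor. *)
Lemma gauss_equation i j k m u : U u ->
  \sum_l riemann gram l k i j u * gram u l m =
  sff u j k * sff u i m - sff u i k * sff u j m
  + c * (gram u j k * gram u i m - gram u i k * gram u j m).
Proof.
move=> Uu.
have E1 := gauss_formula_derive i j k m Uu.
have E2 := gauss_formula_derive j i k m Uu.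
have E3 : partial i (partial j (partial k F)) u = partial j (partial i (partial k F)) u.
  by apply: (partial_comm oU i j _ Uu) => s v Uv; have := sF (rcons s k) Uv; rewrite /iter_partial foldr_rcons.
rewrite E3 in E1.
have alg (b x y z w : R) : (b + x + c * y) - (b + z + c * w) = x - z + c * (y - w).
  by ring.
rewrite -(alg (B (partial j (partial i (partial k F)) u) (partial m F u))) -E1 -E2.
rewrite -sumrB; apply: eq_bigr => l _; rewrite -mulrBl; congr (_ * _).
by rewrite /riemann sumrB opprD addrACA.
Qed.

(** With A = h g^-1 this says that the Ricci operator is (tr A) A - A^2 + (n -
    1) c. *)
Lemma ricci_gauss u : U u ->
  ricci gram u = (\tr (sff u *m invmx (gram u))) *: sff u
    - sff u *m invmx (gram u) *m sff u + (n.-1%:R * c) *: gram u.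
Proof.
move=> Uu; have gu := gram_unit Uu.
set G := invmx (gram u).
have riemE l k i j : riemann gram l k i j u =
   \sum_m (sff u j k * sff u i m - sff u i k * sff u j m
  + c * (gram u j k * gram u i m - gram u i k * gram u j m)) * G m l.
  pose r : 'rV[R]_n := \row_l riemann gram l k i j u.
  have -> : riemann gram l k i j u = (r *m gram u *m G) 0 l.
    by rewrite mulmxK// mxE.
  rewrite mxE; apply: eq_bigr => m _; congr (_ * _).
  rewrite -gauss_equation// mxE; apply: eq_bigr => q _.
  by rewrite mxE.
apply/matrixP => j k; rewrite -(@curvature_contraction _ _ _ _ G c) ?mulmxV// mxE.
by apply: eq_bigr => i _; rewrite riemE.
Qed.

End Gauss.

(** * Principal curvatures with prescribed Ricci eigenvalues *)

Lemma card_eq_perm (T : eqType) n (f g : 'I_n -> T) :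
  (forall a, #|[pred i | f i == a]| = #|[pred i | g i == a]|) ->
  exists s : {perm 'I_n}, forall i, f (s i) = g i.
Proof.
move=> fg.
have : perm_eq (map_tuple g (ord_tuple n)) (map_tuple f (ord_tuple n)).
  change (perm_eq (codom g) (codom f)).
  by apply/allP => a _ /=; rewrite !count_mem_codom fg.
move=> /tuple_permP[s sE]; exists s => i.
have /(congr1 (fun t => tnth t i)) : map_tuple g (ord_tuple n) =
    [tuple tnth (map_tuple f (ord_tuple n)) (s i) | i < n] by exact: val_inj.
by rewrite tnth_mktuple !tnth_map !tnth_ord_tuple.
Qed.

Section Pointwise.
Variable R : realType.

(** Ric is a polynomial in A, so a basis that diagonalizes A diagonalizes Ric
    as well. *)
Lemma gauss_spectrum n (g h : 'M[R]_n) (k : R) (A := h *m invmx g)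
    (Ric := (\tr A *: h - A *m h + k *: g) *m invmx g) :
  g^T = g -> posdef g -> h^T = h ->
  exists d : 'I_n -> R, [/\ \tr A = \sum_i d i,
    forall x, \det (x%:M - A) = \prod_i (x - d i),
    forall a, \rank (eigenspace A a) = #|[pred i | d i == a]|
  & forall a, \rank (eigenspace Ric a) =
      #|[pred i | (\sum_i d i) * d i - d i ^+ 2 + k == a]|].
Proof.
move=> gT pg hT; have gu := posdef_unit pg.
have [P [d [Pu PA]]] := self_adjoint_diagonalizable gT pg hT.
rewrite -/A in PA.
have AE : A = invmx P *m diag_mx d *m P by rewrite -mulmxA -PA mulKmx.
have trA : \tr A = \sum_i d 0 i.
  by rewrite AE -mulmxA mxtrace_mulC -mulmxA mulmxV// mulmx1 mxtrace_diag.
have RicE : Ric = \tr A *: A - A *m A + k%:M.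
  rewrite /Ric !mulmxDl mulNmx -!scalemxAl mulmxV// -[A *m h *m _]mulmxA.
  by rewrite scalemx1.
exists (fun i => d 0 i); split => //.
- exact: det_sub_similar_diag Pu PA.
- by move=> a; exact: rank_eigenspace_diag Pu PA.
move=> a; rewrite -trA.
have PR : P *m Ric = diag_mx (\row_i (\tr A * d 0 i - d 0 i ^+ 2 + k)) *m P.
  rewrite RicE !mulmxDr mulmxN -scalemxAr PA mulmxA PA -mulmxA PA mulmxA scalar_mxC.
  rewrite scalemxAl -mulmxBl -mulmxDl; congr (_ *m P); apply/matrixP => i j.
  rewrite mul_diag_mx !mxE; case: eqP => _; rewrite ?mulr1n ?mulr0n; ring.
rewrite (rank_eigenspace_diag _ Pu PR); apply: eq_card => i.
by rewrite !inE mxE.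
Qed.

(** Each d_i is a root of X^2 - H X + mu_i, whose discriminant is (2 d_i -
    H)^2. The relation on H is the sum of the equations 2 d_i - H = e_i sqrt
    (H^2 - 4 mu_i). *)
Lemma curvature_branch n (d mu : 'I_n -> R) (H := \sum_i d i) :
  (2 <= n)%N ->
  (forall i, H * d i - d i ^+ 2 = mu i) ->
  exists e : {ffun 'I_n -> bool},
  [/\ forall i, 0 <= H ^+ 2 - 4 * mu i,
      branch_sum mu e (n - 2)%:R H = 0 &
      forall i, d i = (H + (-1) ^+ e i * Num.sqrt (H ^+ 2 - 4 * mu i)) / 2].
Proof.
move=> n2 dE; exists [ffun i => 2 * d i - H < 0].
have sq i : H ^+ 2 - 4 * mu i = (2 * d i - H) ^+ 2 by rewrite -dE; ring.
have br i : (-1) ^+ (2 * d i - H < 0)%R * Num.sqrt (H ^+ 2 - 4 * mu i) = 2 * d i - H.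
  rewrite sq sqrtr_sqr; case: (ltP (2 * d i - H) 0) => s.
    by rewrite expr1 ltr0_norm// mulN1r opprK.
  by rewrite expr0 ger0_norm// mul1r.
split=> [i||i].
- by rewrite sq sqr_ge0.
- rewrite /branch_sum; under eq_bigr do rewrite ffunE br.
  rewrite sumrB -mulr_sumr -/H sumr_const card_ord -mulr_natl natrB//; ring.
- by rewrite ffunE br addrCA subrr addr0 mulrC mulKf// pnatr_eq0.
Qed.

End Pointwise.

Lemma connected_const (R : realType) (T : topologicalType) (F : T -> R) :
  connected [set: T] -> continuous F ->
  (forall a b, a < b -> (forall x, a < x < b -> exists r, F r = x) -> False) ->
  forall p q, F p = F q.
Proof.
move=> cT cF noint.
suff W p q : F p < F q -> False.
  by move=> p q; have [/W|/W|] := ltgtP (F p) (F q).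
move=> pq; apply: (noint _ _ pq) => x /andP[px xq].
have cR : connected (F @` [set: T]).
  apply: connected_continuous_connected => //; exact: continuous_subspaceT.
have [] : (F @` [set: T]) x; last by move=> r _ <-; exists r.
apply: ((connected_intervalP _).1 cR (F p) (F q)); [by exists p|by exists q|].
by rewrite (ltW px) (ltW xq).
Qed.

Lemma connected_finite_const (R : realType) (T : topologicalType) (F : T -> R) (s : seq R) :
  connected [set: T] -> continuous F -> (forall p, F p \in s) ->
  forall p q, F p = F q.
Proof.
move=> cT cF Fs; apply: connected_const => // a b ab onto.
have [b' [ab' bb' bs]] := avoid_interval s ab.
have mid : a < (a + b') / 2 < b' by apply/andP; split; lra.
have [|r rE] := onto ((a + b') / 2); first by lra.
by have := bs _ mid; rewrite -rE Fs.
Qed.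

(** * Changes of charts *)

Section Charts.
Variables (R : realType) (n : nat) (M : smooth_manifold R n).
Implicit Types (phi psi : chart R n M) (p : M).

Lemma open_codom phi : atlas phi -> open (chart_codom phi).
Proof. by move=> /atlas_chart[]. Qed.

Lemma chart_codom_map phi p : chart_dom phi p -> chart_codom phi (chart_map phi p).
Proof. by move=> dp; exists p. Qed.

Lemma chart_mapK phi p : atlas phi -> chart_dom phi p ->
  chart_inv phi (chart_map phi p) = p.
Proof. by move=> /atlas_chart[_ _ + _ _]; exact. Qed.

Lemma chart_dom_near phi p : atlas phi -> chart_dom phi p ->
  \forall q \near p, chart_dom phi q.
Proof. by move=> /atlas_chart[od _ _ _ _] dp; exact: open_nbhs_nbhs. Qed.

Lemma chart_map_continuous phi p : atlas phi -> chart_dom phi p ->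
  {for p, continuous (chart_map phi)}.
Proof.
move=> /atlas_chart[od _ _ cm _] dp.
by move: cm; rewrite continuous_open_subspace// => /(_ p); apply; rewrite inE.
Qed.

Lemma chart_inv_continuous phi u : atlas phi -> chart_codom phi u ->
  {for u, continuous (chart_inv phi)}.
Proof.
move=> /atlas_chart[_ oc _ _ ci] du.
by move: ci; rewrite continuous_open_subspace// => /(_ u); apply; rewrite inE.
Qed.

(** T is the Jacobian matrix of the transition map from psi to phi. The same T
    serves for all maps X, in particular for the immersion and for its unit
    normal. *)
Lemma chart_change phi psi p : atlas phi -> atlas psi ->
  chart_dom phi p -> chart_dom psi p ->
  exists T : 'M[R]_n, forall m (X : M -> 'rV[R]_m.+1) i, smooth_map X ->
    partial i (local_expr X psi) (chart_map psi p) =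
    \sum_k T i k *: partial k (local_expr X phi) (chart_map phi p).
Proof.
move=> phiA psiA dphi dpsi.
pose u := chart_map psi p; pose tau := chart_map phi \o chart_inv psi.
have dtau : differentiable tau u.
  by apply: (atlas_smooth psiA phiA [::]); exists p.
have tau_u : tau u = chart_map phi p by rewrite /tau /= chart_mapK.
(* Row i is the derivative of tau along the i-th coordinate of psi. *)
exists (\matrix_(i, k) ('d tau u (delta_mx 0 i)) 0 k) => m X i sX.
have dF : differentiable (local_expr X phi) (tau u).
  by rewrite tau_u; apply: (sX phi phiA [::]); exists p.
have near_tau : \forall v \near u, local_expr X psi v = (local_expr X phi \o tau) v.
  have nd : \forall v \near u, chart_dom phi (chart_inv psi v).
    apply: (chart_inv_continuous psiA (chart_codom_map dpsi)).
    by rewrite chart_mapK//; exact: chart_dom_near.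
  by apply: filterS nd => v dv; rewrite /local_expr /tau /= chart_mapK.
rewrite partialE (near_eq_derive _ near_tau) deriveE; last exact: differentiable_comp.
rewrite diff_comp//= -deriveE// deriveEjacobian// mulmx_sum_row tau_u.
apply: eq_bigr => k _; rewrite mxE rowE -deriveEjacobian -?tau_u//.
Qed.

End Charts.

(** * Shape operator and Ricci operator of a hypersurface *)

Section Hypersurface.
Variables (R : realType) (n : nat) (c : R) (M : smooth_manifold R n).
Variables (f nu : M -> 'rV[R]_n.+2).
Hypotheses (fM : immersed_hypersurface c f) (nuM : unit_normal_field c f nu).
Implicit Types (phi psi : chart R n M) (p : M).
Local Notation F phi := (local_expr f phi).
Local Notation N phi := (local_expr nu phi).

Let sF phi : atlas phi -> smooth_on (chart_codom phi) (F phi).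
Proof. by case: fM => sf _ _; exact: sf. Qed.
Let sN phi : atlas phi -> smooth_on (chart_codom phi) (N phi).
Proof. by case: nuM => sf _ _ _; exact: sf. Qed.
Let FQ phi v : chart_codom phi v -> space_form c (F phi v).
Proof. by case: fM => _ fQ _ _; exact: fQ. Qed.
Let Frank phi (phiA : atlas phi) v : chart_codom phi v -> row_free ('J (F phi) v).
Proof. by case: fM => _ _ rf; exact: rf. Qed.
Let Ntan phi v : chart_codom phi v -> space_form_tangent c (F phi v) (N phi v).
Proof. by case: nuM => _ nt _ _ _; exact: nt. Qed.
Let Nunit phi v : chart_codom phi v -> ambient_form c (N phi v) (N phi v) = 1.
Proof. by case: nuM => _ _ n1 _ _; exact: n1. Qed.
Let Nnormal phi (phiA : atlas phi) v i : chart_codom phi v ->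
  ambient_form c (N phi v) (partial i (F phi) v) = 0.
Proof. by case: nuM => _ _ _ nf vU; exact: nf. Qed.

Let G phi p := gram c (F phi) (chart_map phi p).
Let S phi p := sff c (F phi) (N phi) (chart_map phi p).

Lemma shape_operatorE phi p : shape_operator c f nu phi p = S phi p *m invmx (G phi p).
Proof. by []. Qed.

Lemma ricci_operatorE phi p : atlas phi -> chart_dom phi p ->
  ricci_operator c f phi p =
  (\tr (S phi p *m invmx (G phi p)) *: S phi p
   - S phi p *m invmx (G phi p) *m S phi p + (n.-1%:R * c) *: G phi p)
    *m invmx (G phi p).
Proof.
move=> phiA dp; have pU := chart_codom_map dp.
have E := ricci_gauss (open_codom phiA) (sF phiA) (sN phiA) (@FQ phi) (Frank phiA)
  (@Ntan phi) (@Nunit phi) (Nnormal phiA) pU.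
rewrite -[LHS]/(ricci (gram c (F phi)) (chart_map phi p) *m invmx (G phi p)).
by rewrite E.
Qed.

Lemma metric_posdef phi p : atlas phi -> chart_dom phi p -> posdef (G phi p).
Proof.
move=> phiA /chart_codom_map pU.
exact: (gram_posdef (open_codom phiA) (sF phiA) (@FQ phi) (Frank phiA) pU).
Qed.

Lemma metric_unit phi p : atlas phi -> chart_dom phi p -> G phi p \in unitmx.
Proof. by move=> phiA dp; apply/posdef_unit/metric_posdef. Qed.

Lemma second_form_sym phi p : atlas phi -> chart_dom phi p -> (S phi p)^T = S phi p.
Proof.
move=> phiA /chart_codom_map pU.
exact: (sff_sym (open_codom phiA) (sF phiA) (sN phiA) (Nnormal phiA) pU).
Qed.

Lemma principal_curvatures phi p : atlas phi -> chart_dom phi p ->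
  exists d : 'I_n -> R, [/\ \tr (shape_operator c f nu phi p) = \sum_i d i,
    forall x, \det (x%:M - shape_operator c f nu phi p) = \prod_i (x - d i),
    forall a, multiplicity (shape_operator c f nu phi p) a = #|[pred i | d i == a]|
  & forall a, multiplicity (ricci_operator c f phi p) a =
      #|[pred i | (\sum_i d i) * d i - d i ^+ 2 + n.-1%:R * c == a]|].
Proof.
move=> phiA dp; rewrite (ricci_operatorE phiA dp) shape_operatorE.
apply: gauss_spectrum; [exact: gram_sym|exact: metric_posdef|exact: second_form_sym].
Qed.

Lemma form_congruence (X X' Y Y' : 'I_n -> 'rV[R]_n.+2) (T : 'M[R]_n) :
  (forall i, X' i = \sum_k T i k *: X k) -> (forall i, Y' i = \sum_k T i k *: Y k) ->
  \matrix_(i, j) ambient_form c (X' i) (Y' j) =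
  T *m (\matrix_(i, j) ambient_form c (X i) (Y j)) *m T^T.
Proof.
move=> XE YE; apply/matrixP => i j; rewrite !mxE XE YE ambient_form_sumr.
apply: eq_bigr => l _; rewrite ambient_formZr ambient_form_suml !mxE mulrC.
by congr (_ * _); apply: eq_bigr => k _; rewrite ambient_formZl mxE.
Qed.

(** The metric and the second fundamental form both change by congruence with
    the Jacobian matrix T of the transition map. *)
Lemma shape_operator_change phi psi p : atlas phi -> atlas psi ->
  chart_dom phi p -> chart_dom psi p ->
  exists2 T : 'M[R]_n, T \in unitmx &
    shape_operator c f nu psi p = T *m shape_operator c f nu phi p *m invmx T.
Proof.
move=> phiA psiA dphi dpsi; have [T TE] := chart_change phiA psiA dphi dpsi.
have [sf _ _] := fM; have [snu _ _ _] := nuM.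
have GE : G psi p = T *m G phi p *m T^T.
  by apply: form_congruence => i; exact: TE.
have SE : S psi p = T *m S phi p *m T^T.
  have E : \matrix_(i, j) ambient_form c (partial i (N psi) (chart_map psi p))
       (partial j (F psi) (chart_map psi p)) = T *m (\matrix_(i, j)
       ambient_form c (partial i (N phi) (chart_map phi p))
         (partial j (F phi) (chart_map phi p))) *m T^T.
    by apply: form_congruence => i; exact: TE.
  have SN (chi : chart R n M) : S chi p = - \matrix_(i, j) ambient_form c
      (partial i (N chi) (chart_map chi p)) (partial j (F chi) (chart_map chi p)).
    by apply/matrixP => i j; rewrite !mxE.
  by rewrite (SN psi) (SN phi) mulmxN mulNmx -E.
have Gu := metric_unit psiA dpsi; have Gu' := metric_unit phiA dphi.
have Tu : T \in unitmx by move: Gu; rewrite GE !unitmx_mul => /andP[/andP[]].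
exists T => //; rewrite !shape_operatorE SE.
apply: (can_inj (mulmxK Gu)); rewrite GE in Gu *.
by rewrite mulmxKV// !mulmxA mulmxKV// mulmxKV.
Qed.

(** Such a Q turns the shape operator into a continuous function on M: its
    value does not depend on the chart ([invariant_atE],
    [invariant_continuous]). *)
Definition conj_invariant (Q : 'M[R]_n -> R) :=
  (forall A T : 'M[R]_n, T \in unitmx -> Q (T *m A *m invmx T) = Q A) /\
  (forall (A : 'rV[R]_n -> 'M[R]_n) u, (forall i j, differentiable (fun v => A v i j) u) ->
     differentiable (Q \o A) u).

Lemma conj_invariant_trace : conj_invariant mxtrace.
Proof.
split=> [A T Tu|A u dA].
  by rewrite mxtrace_mulC mulmxA mulVmx// mul1mx.
exact: differentiable_bigsum.
Qed.

Lemma conj_invariant_charpoly x : conj_invariant (fun A => \det (x%:M - A)).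
Proof.
split=> [A T Tu|A u dA].
  have -> : x%:M - T *m A *m invmx T = T *m (x%:M - A) *m invmx T.
    by rewrite mulmxBr mulmxBl scalar_mxC -(mulmxA x%:M) mulmxV// mulmx1.
  by rewrite !det_mulmx mulrAC -det_mulmx mulmxV// det1 mul1r.
apply: differentiable_det => i j; under eq_fun do rewrite !mxE.
by apply: differentiableB => //; exact: differentiable_cst.
Qed.

Definition chart_at p : chart R n M := projT1 (cid2 (atlas_cover p)).

Lemma chart_at_atlas p : atlas (chart_at p).
Proof. by rewrite /chart_at; case: cid2. Qed.

Lemma chart_at_dom p : chart_dom (chart_at p) p.
Proof. by rewrite /chart_at; case: cid2. Qed.

Definition invariant_at (Q : 'M[R]_n -> R) p := Q (shape_operator c f nu (chart_at p) p).

Lemma invariant_atE Q phi p : conj_invariant Q -> atlas phi -> chart_dom phi p ->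
  Q (shape_operator c f nu phi p) = invariant_at Q p.
Proof.
move=> [Qc _] phiA dp.
have [T Tu ->] := shape_operator_change (chart_at_atlas p) phiA (chart_at_dom p) dp.
exact: Qc.
Qed.

Lemma invariant_continuous Q : conj_invariant Q -> continuous (invariant_at Q).
Proof.
move=> Qi p; pose phi := chart_at p.
have phiA := chart_at_atlas p; have dp := chart_at_dom p; have pU := chart_codom_map dp.
rewrite -/phi in phiA dp pU.
(* A v is the shape operator at the point with coordinates v. *)
pose A v := sff c (F phi) (N phi) v *m cramer_inv (gram c (F phi) v).
have Gd i j := differentiable_gram c (sF phiA) i j pU.
have dA : differentiable (Q \o A) (chart_map phi p).
  apply: Qi.2 => i j; under eq_fun do rewrite mxE.
  apply: differentiable_bigsum => k; apply: differentiableM.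
    exact: (differentiable_sff c (sF phiA) (sN phiA) i k pU).
  apply: differentiable_cramer_inv; first exact: Gd.
  exact: (metric_unit phiA dp).
have cQ : {for p, continuous (Q \o A \o chart_map phi)}.
  apply: continuous_comp; first exact: chart_map_continuous.
  exact: differentiable_continuous.
have E : \forall q \near p, (Q \o A \o chart_map phi) q = invariant_at Q q.
  apply: filterS (chart_dom_near phiA dp) => q dq.
  rewrite -(invariant_atE Qi phiA dq) /= shape_operatorE /A.
  by rewrite invmx_cramer//; exact: (metric_unit phiA dq).
have Ep : (Q \o A \o chart_map phi) p = invariant_at Q p by exact: (nbhs_singleton E).
rewrite /continuous_at -Ep.
exact: cvg_trans (near_eq_cvg E) cQ.
Qed.

End Hypersurface.

(** * Constancy of the principal curvatures *)

Section Rigidity.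
Variables (R : realType) (n : nat) (c : R) (M : smooth_manifold R n).
Variables (f nu : M -> 'rV[R]_n.+2).
Hypotheses (n3 : (3 <= n)%N) (cM : connected [set: M]).
Hypotheses (fM : immersed_hypersurface c f) (nuM : unit_normal_field c f nu).
Hypothesis ricM : constant_ricci_eigenvalues c f.
Local Notation k := (n.-1%:R * c).
Local Notation A phi p := (shape_operator c f nu phi p).
Local Notation H := (invariant_at c f nu mxtrace).

(** The numbers mu_i are the Ricci eigenvalues at p0 minus (n - 1) c. At any
    other point the principal curvatures can be renumbered so that their Ricci
    eigenvalues come in the same order as at p0. *)
Lemma constant_ricci_branches (p0 : M) : exists mu : 'I_n -> R,
  (forall a, multiplicity (ricci_operator c f (chart_at p0) p0) a =
     #|[pred i | mu i + k == a]|) /\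
  forall phi p, atlas phi -> chart_dom phi p ->
  exists e : {ffun 'I_n -> bool},
  let d i := (H p + (-1) ^+ e i * Num.sqrt (H p ^+ 2 - 4 * mu i)) / 2 in
  [/\ forall i, 0 <= H p ^+ 2 - 4 * mu i, branch_sum mu e (n - 2)%:R (H p) = 0,
      forall x, \det (x%:M - A phi p) = \prod_i (x - d i) &
      forall a, multiplicity (A phi p) a = #|[pred i | d i == a]|].
Proof.
have phi0A := chart_at_atlas p0; have dp0 := chart_at_dom p0.
have [d0 [_ _ _ ric0]] := principal_curvatures fM nuM phi0A dp0.
exists (fun i => (\sum_i d0 i) * d0 i - d0 i ^+ 2); split => // phi p phiA dp.
have [d [trE detE mulE ricE]] := principal_curvatures fM nuM phiA dp.
have [|s sE] := @card_eq_perm _ _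
    (fun i => (\sum_i d i) * d i - d i ^+ 2 + k)
    (fun i => (\sum_i d0 i) * d0 i - d0 i ^+ 2 + k).
  by move=> a; rewrite -ric0 -ricE; apply: ricM.
have trH : \sum_i d (s i) = H p.
  rewrite -(invariant_atE fM nuM (@conj_invariant_trace R n) phiA dp) trE.
  by rewrite [RHS](reindex_inj (@perm_inj _ s)).
have trd : \sum_i d (s i) = \sum_i d i by rewrite [RHS](reindex_inj (@perm_inj _ s)).
move: (H p) trH => _ <-.
have [|i|e [disc branch dE]] := @curvature_branch R n (fun i => d (s i))
    (fun i => (\sum_i d0 i) * d0 i - d0 i ^+ 2).
- exact: leq_trans n3.
- by apply: (addIr k); rewrite trd sE.
exists e; split; [exact: disc|exact: branch|move=> x|move=> a].
  rewrite detE (reindex_inj (@perm_inj _ s)); apply: eq_bigr => i _.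
  by rewrite -dE.
rewrite mulE -sum1_card (reindex_inj (@perm_inj _ s)) -[RHS]sum1_card.
by apply: eq_bigl => i; rewrite !inE -dE.
Qed.

(** Otherwise [branch_rigidity] applies to an interval of values of H: the
    multiplicity of (n - 1) c is n or n - 2, which is positive, and at most one
    Ricci eigenvalue is different from (n - 1) c. Each of the three conditions
    contradicts this. *)
Lemma mean_curvature_constant :
  [\/ three_distinct_ricci_eigenvalues c f, not_ricci_eigenvalue c f k
    | ricci_multiplicity_notin c f k [:: n; (n - 2)%N]] ->
  forall p q, H p = H q.
Proof.
move=> cond p q.
apply: (connected_const cM (invariant_continuous fM nuM (@conj_invariant_trace R n))).
move=> a b ab onto; have [mu [muE br]] := constant_ricci_branches p.
have [|m0 mu_eq] := @branch_rigidity R n mu _ _ n3 ab.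
  move=> x /onto[r <-].
  have [e [d br0 _ _]] := br _ r (chart_at_atlas r) (chart_at_dom r).
  by exists e; split; [exact: d | exact: br0].
have mk : multiplicity (ricci_operator c f (chart_at p) p) k = #|[pred i | mu i == 0]|.
  by rewrite muE; apply: eq_card => i; rewrite !inE -[LHS]subr_eq0 addrK.
have pA := chart_at_atlas p; have dp := chart_at_dom p.
case: cond => [[a1 [a2 [a3 [au ae]]]]|nk|mn].
- have := ae _ pA _ dp; rewrite /= => /and4P[e1 e2 e3 _].
  have pick a0 : eigenvalue (ricci_operator c f (chart_at p) p) a0 ->
      exists i, mu i + k = a0.
    rewrite /eigenvalue -mxrank_eq0 -lt0n -/(multiplicity _ _) muE => /card_gt0P[j].
    by rewrite inE => /eqP ja; exists j.
  have same a0 b0 : a0 != k -> b0 != k -> eigenvalue (ricci_operator c f (chart_at p) p) a0 ->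
      eigenvalue (ricci_operator c f (chart_at p) p) b0 -> a0 = b0.
    move=> ak bk /pick[i ia] /pick[j jb]; rewrite -ia -jb in ak bk *.
    congr (_ + _); apply: mu_eq.
      by apply: contra_neq ak => ->; rewrite add0r.
    by apply: contra_neq bk => ->; rewrite add0r.
  move: au; rewrite /= !inE negb_or andbT => /andP[/andP[a12 a13] a23].
  have [a1k|a1k] := eqVneq a1 k.
    case/eqP: a23; apply: same => //; first by rewrite -a1k eq_sym.
    by rewrite -a1k eq_sym.
  have [a2k|a2k] := eqVneq a2 k.
    by case/eqP: a13; apply: same => //; rewrite -a2k eq_sym.
  by case/eqP: a12; apply: same.
- have := nk _ pA _ dp; rewrite /eigenvalue -mxrank_eq0 negbK -/(multiplicity _ _) mk.
  by case: m0 => -> /eqP; lia.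
- by have := mn _ pA _ dp; rewrite mk !inE; case: m0 => ->; rewrite eqxx ?orbT.
Qed.

(** For a fixed value of H there is one candidate for the characteristic
    polynomial per choice of signs, and a continuous function on M with
    finitely many values is constant. *)
Lemma isoparametric_of_constant_mean_curvature :
  (forall p q, H p = H q) -> isoparametric c f nu.
Proof.
move=> Hconst phi psi phiA psiA p q dp dq a.
have [mu [_ br]] := constant_ricci_branches p.
pose d (e : {ffun 'I_n -> bool}) i := (H p + (-1) ^+ e i * Num.sqrt (H p ^+ 2 - 4 * mu i)) / 2.
have brd chi r : atlas chi -> chart_dom chi r -> exists e,
    (forall x, \det (x%:M - A chi r) = \prod_i (x - d e i)) /\
    (forall b, multiplicity (A chi r) b = #|[pred i | d e i == b]|).
  move=> chiA dr; have [e [_ _ det mul]] := br chi r chiA dr.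
  by rewrite (Hconst r p) in det mul; exists e.
have [e [dete mule]] := brd _ _ phiA dp.
have [e' [dete' mule']] := brd _ _ psiA dq.
apply: etrans (mule a) (etrans _ (esym (mule' a))).
apply: card_eq_of_prod_sub_eq => x.
have Qi := @conj_invariant_charpoly R n x.
apply: etrans (esym (dete x)) (etrans _ (dete' x)).
apply: etrans (invariant_atE fM nuM Qi phiA dp) _.
apply: etrans _ (esym (invariant_atE fM nuM Qi psiA dq)).
pose cp (e : {ffun 'I_n -> bool}) := \prod_i (x - d e i).
apply: (connected_finite_const (s := codom cp) cM (invariant_continuous fM nuM Qi)) => r.
have rA := chart_at_atlas r; have dr := chart_at_dom r.
have [e2 [dete2 _]] := brd _ _ rA dr.
have -> : invariant_at c f nu (fun B => \det (x%:M - B)) r = \prod_i (x - d e2 i).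
  exact: etrans (esym (invariant_atE fM nuM Qi rA dr)) (dete2 x).
exact: (codom_f cp e2).
Qed.

End Rigidity.

Theorem corollary1p8 (R : realType) (n : nat) (c : R)
    (M : smooth_manifold R n) (f nu : M -> 'rV[R]_n.+2) :
  (3 <= n)%N ->
  connected [set: M] ->
  immersed_hypersurface c f ->
  unit_normal_field c f nu ->
  constant_ricci_eigenvalues c f ->
  [\/ three_distinct_ricci_eigenvalues c f,
      not_ricci_eigenvalue c f ((n.-1)%:R * c)
    | ricci_multiplicity_notin c f ((n.-1)%:R * c) [:: n; (n - 2)%N]] ->
  isoparametric c f nu.
Proof.
move=> n3 cM fM nuM ricM cond.
have Hconst := mean_curvature_constant n3 cM fM nuM ricM cond.
exact: (isoparametric_of_constant_mean_curvature n3 cM fM nuM ricM Hconst).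
Qed.
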